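(* Let $\sigma:\Sigma\to\Sigma$ be a topologically transitive one-sided subshift of finite type and let $\psi:\Sigma\to\mathbb{R}$, $v:\Sigma\to(-\infty,0)$ and $u:\Sigma\to(0,+\infty)$ be Hölder continuous. For $\alpha\in\mathbb{R}$ set $$\mathcal{L}^\alpha_{\psi,v}=\Big\{\xi\in\Sigma:\lim_{n\to+\infty}\frac{S_n\psi(\xi)}{S_nv(\xi)}=\alpha\Big\},\qquad \mathcal{UL}^\alpha_{\psi,v}=\Big\{\xi\in\Sigma:\sup_{n\in\mathbb{N}}|S_n\psi(\xi)-\alpha S_nv(\xi)|<+\infty\Big\}.$$ Then for every $\alpha\in\mathbb{R}$, $\dim_u(\mathcal{UL}^\alpha_{\psi,v})=\dim_u(\mathcal{L}^\alpha_{\psi,v})$.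
   Context: Subshift of finite type (SFT): $A$ is a finite set with at least two symbols, and $\mathbb{M}:A\times A\to\{0,1\}$ is a matrix such that for each $a\in A$ there is $b\in A$ with $\mathbb{M}(a,b)=1$. A word or infinite sequence over $A$ is admissible if each of its subwords $ab$ of length two (consecutive letters) satisfies $\mathbb{M}(a,b)=1$ (the empty word and words of length one are admissible). $\Sigma\subseteq A^{\mathbb{N}}$ ($\mathbb{N}=\{1,2,\dots\}$) is the set of admissible sequences and $\sigma(\xi_1\xi_2\cdots)=\xi_2\xi_3\cdots$. The SFT is topologically transitive iff for all $a,b\in A$ there is an admissible word $\rho$ (possibly empty) with $a\rho b$ admissible. For an admissible word $\omega$ of length $|\omega|$, $[\omega]=\{\xi\in\Sigma:\xi_1\cdots\xi_{|\omega|}=\omega\}$; $[\text{empty word}]=\Sigma$. Birkhoff sums: $S_nf=\sum_{k=0}^{n-1}f\circ\sigma^k$, $S_0f=0$; for an admissible word $\omega$, $S_\omega f=\sup_{\xi\in[\omega]}S_{|\omega|}f(\xi)$. Metrics: for distinct $\xi,\xi'\in\Sigma$ let $\xi\wedge\xi'$ be their longest common initial block; $d_1(\xi,\xi')=\exp(-|\xi\wedge\xi'|)$. Hölder continuity of functions on $\Sigma$ is with respect to $d_1$ (with some positive exponent). For Hölder continuous $u:\Sigma\to(0,+\infty)$, $d_u(\xi,\xi')=\exp(S_{\xi\wedge\xi'}(-u))$ for $\xi\neq\xi'$, which is a metric on $\Sigma$. The $u$-dimension $\dim_u(E)$ of $E\subseteq\Sigma$ is the Hausdorff dimension of $E$ in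 $(\Sigma,d_u)$ (with $\dim_u\varnothing=0$). *)

(* Defs.v *)
From HB Require Import structures.
From mathcomp Require Import all_boot all_order all_algebra.
From mathcomp Require Import all_classical all_reals all_analysis.
Set Implicit Arguments.
Unset Strict Implicit.
Unset Printing Implicit Defensive.
Import Order.TTheory GRing.Theory Num.Theory.
Import numFieldNormedType.Exports.
Local Open Scope classical_set_scope.
Local Open Scope ring_scope.

Section Hausdorff.
Context {R : realType} {T : Type}.
Variable d : T -> T -> R.

Definition diameter (U : set T) : \bar R :=
  ereal_sup [set (d p.1 p.2)%:E | p in U `*` U].

(* The empty set is singled out because 0 `^ 0 = 1, which is the convention
   wanted for one-point sets only. *)
Definition diameter_pow (s : R) (U : set T) : \bar R :=
  if U == set0 then 0%E else (diameter U `^ s)%E.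

(* Finite covers are included, since the sets U k may be empty. *)
Definition hausdorff_content (s delta : R) (E : set T) : \bar R :=
  ereal_inf [set (\sum_(0 <= k <oo) diameter_pow s (U k))%E | U in
    [set U : nat -> set T | E `<=` \bigcup_k U k /\
                            forall k, (diameter (U k) <= delta%:E)%E]].

Definition hausdorff_measure (s : R) (E : set T) : \bar R :=
  ereal_sup [set hausdorff_content s delta E | delta in [set x : R | 0 < x]].

Definition hausdorff_dim (E : set T) : \bar R :=
  ereal_inf [set s%:E | s in [set s : R | 0 <= s /\ hausdorff_measure s E = 0%E]].

End Hausdorff.

Section Subshift.
Context {A : finType}.
Variable M : rel A.

(* Sequences are indexed from 0: the letter xi_n of the usual notation
   (n >= 1) is [val xi n.-1]. *)
Definition Sigma : set (nat -> A) := [set xi | forall n, M (xi n) (xi n.+1)].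

Definition admissible (w : seq A) : bool := sorted M w.

Definition topologically_transitive : Prop :=
  forall a b : A, exists rho : seq A,
    admissible rho /\ admissible (a :: rcons rho b).

Lemma shift_subproof (xi : Sigma) : (fun n => val xi n.+1) \in Sigma.
Proof. by apply/mem_set => n; exact: (set_mem (valP xi)). Qed.

Definition sigma (xi : Sigma) : Sigma := SigSub (shift_subproof xi).

Definition cylinder (w : seq A) : set Sigma :=
  [set xi | mkseq (val xi) (size w) = w].

(* Length of the longest common initial block of xi and xi', that is, the
   least index at which they differ; the value at xi = xi' is irrelevant. *)
Definition common_length (xi xi' : Sigma) : nat :=
  if pselect (exists n, val xi n != val xi' n) is left h then ex_minn h
  else 0%N.

Definition common_block (xi xi' : Sigma) : seq A :=
  mkseq (val xi) (common_length xi xi').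

Context {R : realType}.
Implicit Types (f psi u v : Sigma -> R) (w : seq A).

Definition birkhoff_sum (n : nat) f (xi : Sigma) : R :=
  \sum_(0 <= k < n) f (iter k sigma xi).

(* Real supremum: it is meaningful for bounded f, in particular for Hoelder
   continuous f, and w admissible. *)
Definition word_birkhoff_sum w f : R :=
  sup [set birkhoff_sum (size w) f xi | xi in cylinder w].

Definition d1 (xi xi' : Sigma) : R :=
  if pselect (xi = xi') then 0
  else expR (- (size (common_block xi xi'))%:R).

Definition du u (xi xi' : Sigma) : R :=
  if pselect (xi = xi') then 0
  else expR (word_birkhoff_sum (common_block xi xi') (\- u)).

Definition hoelder_continuous f : Prop :=
  exists (e C : R), 0 < e /\
    forall xi xi' : Sigma, `|f xi - f xi'| <= C * d1 xi xi' `^ e.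

Definition dim_u u (E : set Sigma) : \bar R := hausdorff_dim (du u) E.

Definition level_set psi v (alpha : R) : set Sigma :=
  [set xi | (fun n => birkhoff_sum n psi xi / birkhoff_sum n v xi)
              @ \oo --> alpha].

Definition uniform_level_set psi v (alpha : R) : set Sigma :=
  [set xi | (ereal_sup
     [set `|birkhoff_sum n psi xi - alpha * birkhoff_sum n v xi|%:E
       | n in [set n : nat | (0 < n)%N]] < +oo)%E].

End Subshift.

(* Main.v *)
Require Import Defs.
From HB Require Import structures.
From mathcomp Require Import all_boot all_order all_algebra.
From mathcomp Require Import all_classical all_reals all_analysis.
From mathcomp Require Import ring lra.
Set Implicit Arguments.
Unset Strict Implicit.
Unset Printing Implicit Defensive.
Import Order.TTheory GRing.Theory Num.Theory.
Import numFieldNormedType.Exports.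
Local Open Scope classical_set_scope.
Local Open Scope ring_scope.

(** The function [f = psi - alpha v] is Hoelder continuous; the uniform level set
    consists of the points with bounded Birkhoff sums [S_n f], and [S_n f = o(n)]
    on the level set.  Let the uniform level set have [s]-dimensional Hausdorff
    measure zero.  By compactness, for every [K] all long words whose partial sums
    are bounded by [K] start with one of finitely many words of arbitrarily small
    total weight [sum exp (- s0 S u)], [s0 > s].  This forces the words of length
    [n] with [|S f| <= eps n] to have total weight at most [exp (eta n)], with
    [eta] small when [eps] is, so that they provide small covers of the level set.
    Two cases occur.
    - [S f] is unbounded above and below on words.  Then each of these words can be
      completed, by a word of length [O(eps n)], so as to bring the sum back into a
      fixed interval.  If the total weight were large, the tree of free
      concatenations would consist of points with bounded sums, and by a mass
      distribution argument it could not have covers of small weight.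
    - [S f] is, say, bounded below on words.  A word of small total sum is then a
      concatenation of few blocks with bounded partial sums, each of which factors
      into the covering words up to boundedly many letters.  As in Furstenberg's
      theorem on invariant sets, the weight of all such concatenations is
      controlled by that of the covering words. *)

(** * Words and compactness *)

(** Compactness of the full shift. If no bound serves all words extending [w], then none serves
    those extending some [rcons w a], since the letters are finite in number; the infinite sequence
    built in this way contradicts the hypothesis. Bounding [k] as well leaves finitely many
    properties [P k]. *)
Lemma fan (A : finType) (P : nat -> seq A -> Prop) :
  (forall x : nat -> A, exists n k, P k (mkseq x n)) ->
  exists N, forall y : seq A, (N <= size y)%N ->
    exists n k, [/\ (n <= size y)%N, (k < N)%N & P k (take n y)].
Proof.
move=> HP.
pose Q w := exists N, forall y : seq A, prefix w y -> (N <= size y)%N ->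
    exists n k, [/\ (n <= size y)%N, (k < N)%N & P k (take n y)].
suff [N HN] : Q [::] by exists N => y; apply: HN; rewrite prefix0s.
apply: contrapT => nQ0.
have step w : ~ Q w -> exists a, ~ Q (rcons w a).
  move=> nQ; apply: contrapT => nex; apply: nQ.
  have QA a : Q (rcons w a) by apply: contrapT => nQ; apply: nex; exists a.
  have [N HN] := choice QA.
  (* The term [(size w).+1] excludes [y = w], which has no next letter. *)
  exists (maxn (size w).+1 (\max_a N a)) => y /prefixP[[|a v] ->].
    by rewrite cats0 geq_max ltnn.
  rewrite geq_max => /andP[_ le].
  have Nale : (N a <= \max_a N a)%N by exact: leq_bigmax.
  have [||n [k [nle klt Pk]]] := HN a (w ++ a :: v).
  - by rewrite -cat_rcons prefix_prefix.
  - exact: leq_trans le.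
  - by exists n, k; split=> //; rewrite leq_max (leq_trans klt Nale) orbT.
have [a0 _] := step _ nQ0.
have /choice[g Hg] : forall w, exists a, ~ Q w -> ~ Q (rcons w a).
  move=> w; have [Qw|/step[a Ha]] := pselect (Q w); last by exists a.
  by exists a0.
pose ws n := iter n (fun w => rcons w (g w)) [::].
have nQws n : ~ Q (ws n) by elim: n => //= n IH; exact: Hg.
pose x n := g (ws n).
have xE n : mkseq x n = ws n.
  by elim: n => // n IH; rewrite mkseqS IH.
have [n [k Pk]] := HP x.
apply: (nQws n); exists k.+1 => y /prefixP[v ->] _; exists n, k.
have sn : size (ws n) = n by rewrite -xE size_mkseq.
split=> //; first by rewrite size_cat sn leq_addr.
by rewrite -{1}sn take_size_cat // -xE.
Qed.

Fixpoint words (A : finType) (n : nat) : seq (seq A) :=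
  if n is m.+1 then [seq a :: v | a <- enum A, v <- words A m] else [:: [::]].

Lemma mem_words (A : finType) n (w : seq A) :
  (w \in words A n) = (size w == n).
Proof.
elim: n w => [|n IH] [|a w] //=.
- by apply/allpairsP => -[[a v] /= [_ _]].
- apply/allpairsP/idP => [[[b v] /= [_ + [_ ->]]]|]; first by rewrite IH.
  by move=> sw; exists (a, w); rewrite /= mem_enum IH.
Qed.

Lemma words_uniq (A : finType) n : uniq (words A n).
Proof.
elim: n => //= n IH; apply: allpairs_uniq => //; first exact: enum_uniq.
by move=> [a v] [b w] _ _ /= [-> ->].
Qed.

Section WordSums.
Context {R : realType} {A : finType}.
Implicit Types (g h : seq A -> R) (w p : seq A).

Lemma sum_wordsS n g :
  \sum_(w <- words A n.+1) g w = \sum_(a : A) \sum_(w <- words A n) g (a :: w).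
Proof. by rewrite /= big_flatten /= big_map big_enum; under eq_bigr do rewrite big_map. Qed.

Lemma sum_words_prefix p m g :
  \sum_(w <- words A (size p + m) | prefix p w) g (drop (size p) w) =
  \sum_(w <- words A m) g w.
Proof.
elim: p => [|a p IH] /=.
  by rewrite add0n; apply: eq_big => // w; rewrite ?prefix0s ?drop0.
rewrite -/(words A (size p + m).+1) big_mkcond sum_wordsS (bigD1 a) //= [X in _ + X]big1 => [|b ba].
  rewrite addr0 -IH [RHS]big_mkcond.
  by apply: eq_bigr => w _ /=; rewrite eqxx.
rewrite big1 // => w _.
by rewrite eq_sym (negbTE ba).
Qed.

Lemma sum_words_prefix_le p n g : (forall w, 0 <= g w) ->
  \sum_(w <- words A n | prefix p w) g (drop (size p) w) <=
  \sum_(w <- words A (n - size p)) g w.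
Proof.
move=> g0; have [le|lt] := leqP (size p) n.
  by rewrite -{1}(subnKC le) sum_words_prefix.
rewrite big_seq_cond big_pred0 ?sumr_ge0 // => w.
rewrite mem_words; apply: contraTF lt => /andP[/eqP <- /prefixP[v ->]].
by rewrite size_cat -leqNgt leq_addr.
Qed.

End WordSums.

(** * Weighted factorizations of words *)

Section Furstenberg.
Context {R : realType} {A : finType}.
Variables (M : rel A) (phi : seq A -> R) (k z : R) (Ws : seq (seq A)).
Hypotheses (phi_ge0 : forall w, 0 <= phi w) (k_ge0 : 0 <= k) (z_ge0 : 0 <= z).
Hypothesis phi_submult : forall p v, admissible M (p ++ v) ->
  phi (p ++ v) <= k * phi p * phi v.
Hypothesis phi_letter : forall a, phi [:: a] <= 1.

(* Total weight of the factorizations of [w] into letters of weight [k * z] and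
   words [p] of [Ws] of weight [k * phi p]; [n] is a recursion bound, to be at
   least [size w]. *)
Fixpoint fact_weight n w : R :=
  if n is m.+1 then
    if w is a :: v then k * z * fact_weight m v +
      \sum_(p <- Ws | (p != [::]) && prefix p w)
        k * phi p * fact_weight m (drop (size p) w)
    else 1
  else (w == [::])%:R.

Lemma fact_weight_ge0 n w : 0 <= fact_weight n w.
Proof.
elim: n w => [|n IH] [|a w] //=; rewrite addr_ge0 ?mulr_ge0 ?sumr_ge0 // => p _.
by rewrite !mulr_ge0.
Qed.

(** Renewal argument: sorted by first factor, the sum is at most the total weight of one factor
    times a bound for shorter words, which is 1 by induction. *)
Lemma sum_fact_weight_le1 n m : k * (#|A|%:R * z + \sum_(p <- Ws) phi p) <= 1 ->
  \sum_(w <- words A m) fact_weight n w <= 1.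
Proof.
move=> le1; elim: n m => [|n IH] [|m]; rewrite ?[words A 0]/= ?big_seq1 //.
  by rewrite sum_wordsS big1 // => a _; rewrite big1.
have -> : \sum_(w <- words A m.+1) fact_weight n.+1 w =
   \sum_(w <- words A m.+1) (k * z * fact_weight n (behead w)) +
   \sum_(w <- words A m.+1) \sum_(p <- Ws | (p != [::]) && prefix p w)
        k * phi p * fact_weight n (drop (size p) w).
  by rewrite -big_split; apply: eq_big_seq => -[|a w]; rewrite mem_words.
apply: le_trans le1; rewrite mulrDr lerD //.
  rewrite sum_wordsS /= sumr_const -mulr_sumr -mulrnAl -mulr_natl [leRHS]mulrCA.
  by rewrite ler_piMr ?IH // !mulr_ge0.
under eq_bigr do rewrite big_mkcondr/=.
rewrite exchange_big /= mulr_sumr big_mkcond /= ler_sum // => p _.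
case: ifP => [p0|_]; last by rewrite mulr_ge0.
rewrite -big_mkcond -mulr_sumr ler_piMr ?mulr_ge0 //.
apply: le_trans (IH (m.+1 - size p)%N).
exact: (@sum_words_prefix_le _ _ p m.+1 _ (fact_weight_ge0 n)).
Qed.

(** Every sufficient recursion bound is allowed, so that the estimate remains available at the bound
    left after removal of a factor. *)
Definition fact_weight_min (c : R) w :=
  forall n, (size w <= n)%N -> c <= fact_weight n w.

(** The weight [k * z] of a letter pays for the constant of submultiplicativity; a factor [z] is
    lost. *)
Lemma fact_weight_min_letter c a v : 0 <= c -> admissible M (a :: v) ->
  fact_weight_min (c * phi v) v -> fact_weight_min (z * c * phi (a :: v)) (a :: v).
Proof.
move=> c0 adm Hv [|n] //=; rewrite ltnS => /Hv le.
rewrite (le_trans (_ : _ <= k * z * fact_weight n v)) ?lerDl ?sumr_ge0 //; last first.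
  by move=> p _; rewrite !mulr_ge0 ?fact_weight_ge0.
rewrite (le_trans (_ : _ <= k * z * (c * phi v))) ?ler_wpM2l ?mulr_ge0 //.
have := phi_submult (p := [:: a]) adm; rewrite cat1s => leM.
have -> : k * z * (c * phi v) = z * c * (k * 1 * phi v) by ring.
rewrite ler_wpM2l ?mulr_ge0 // (le_trans leM) // ler_wpM2r // ler_wpM2l //.
Qed.

(** The weight [k * phi p] is what submultiplicativity costs, so splitting off a covering word loses
    nothing. *)
Lemma fact_weight_min_word c p v : 0 <= c -> p \in Ws -> p != [::] ->
  admissible M (p ++ v) ->
  fact_weight_min (c * phi v) v -> fact_weight_min (c * phi (p ++ v)) (p ++ v).
Proof.
case: p => // a p c0 pW p0 adm Hv [|n] //; rewrite cat_cons [size _]/= ltnS => le.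
have {le}/Hv le : (size v <= n)%N by rewrite (leq_trans _ le) // size_cat leq_addl.
rewrite [leRHS]/= (le_trans (_ : _ <= k * phi (a :: p) * fact_weight n v)) //; last first.
  rewrite ler_wpDl ?mulr_ge0 ?fact_weight_ge0 // (big_rem _ pW) /= eqxx prefix_prefix /=.
  rewrite drop_size_cat // lerDl sumr_ge0 // => q _.
  by rewrite !mulr_ge0 ?fact_weight_ge0.
rewrite (le_trans (_ : _ <= k * phi (a :: p) * (c * phi v))) ?ler_wpM2l ?mulr_ge0 //.
by rewrite mulrCA ler_wpM2l //; exact: (@phi_submult (a :: p)).
Qed.

Lemma fact_weight_min_letters c y v : 0 <= c -> admissible M (y ++ v) ->
  fact_weight_min (c * phi v) v ->
  fact_weight_min (z ^+ size y * c * phi (y ++ v)) (y ++ v).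
Proof.
move=> c0 + Hv; elim: y => [|a y IH] adm; first by rewrite expr0 mul1r.
rewrite [size _]/= exprS -[z * _ * c]mulrA cat_cons.
apply: fact_weight_min_letter; rewrite ?mulr_ge0 ?exprn_ge0 //.
by apply: IH; have := @cat_sorted2 _ _ [:: a] _ adm => -[].
Qed.

(** Covering words are split off [y] at no loss until fewer than [N] letters are left; these are
    spelled out and lose at most [z ^+ N]. *)
Lemma fact_weight_min_block N c y v : z <= 1 -> 0 <= c -> [::] \notin Ws ->
  (forall l y', y = l ++ y' -> (N <= size y')%N ->
    exists2 p, p \in Ws & prefix p y') ->
  admissible M (y ++ v) -> fact_weight_min (c * phi v) v ->
  fact_weight_min (z ^+ N * c * phi (y ++ v)) (y ++ v).
Proof.
move=> z1 c0 W0; have [n] := ubnP (size y); elim: n y => // n IH y ny Hy adm Hv.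
have [le|lt] := leqP N (size y); last first.
  move=> m /(fact_weight_min_letters c0 adm Hv); apply: le_trans.
  by rewrite ler_wpM2r // ler_wpM2r // ler_wiXn2l // ltnW.
have [p pW /prefixP[y' yE]] := Hy [::] y erefl le.
have p0 : p != [::] by apply: contraNneq W0 => <-.
subst y; rewrite -catA in adm *.
apply: fact_weight_min_word => //; first by rewrite mulr_ge0 ?exprn_ge0.
apply: IH => //.
- move: ny; rewrite size_cat ltnS; apply: leq_trans.
  by rewrite -[ltnLHS]add0n ltn_add2r lt0n size_eq0.
- by move=> l y'' E; apply: (Hy (p ++ l)); rewrite E catA.
- exact: (cat_sorted2 adm).2.
Qed.

End Furstenberg.

(** * Sums bounded on one side *)

Definition almost_additive {R : realType} {A : finType} (M : rel A)
    (F : seq A -> R) (C : R) : Prop :=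
  F [::] = 0 /\ forall w v, admissible M (w ++ v) ->
    `|F (w ++ v) - (F w + F v)| <= C.

(** Finitary form of the vanishing of the Hausdorff measure of the points with bounded sums; [phi]
    stands for a power of the size of a cylinder. *)
Definition small_covers {R : realType} {A : finType} (M : rel A)
    (F phi : seq A -> R) : Prop :=
  forall K delta, 0 < delta -> exists N Ws,
    \sum_(p <- Ws) phi p <= delta /\
    forall y, admissible M y -> (forall i, `|F (take i y)| <= K) ->
      (N <= size y)%N -> exists2 p, p \in Ws & prefix p y.

Lemma le_sum_seq {R : realType} {T : eqType} (r : seq T) (phi : T -> R) p :
  (forall q, 0 <= phi q) -> p \in r -> phi p <= \sum_(q <- r) phi q.
Proof. by move=> phi0 pr; rewrite (big_rem _ pr)/= lerDl sumr_ge0. Qed.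

Section OneSided.
Context {R : realType} {A : finType}.
Variables (M : rel A) (F phi : seq A -> R) (C K0 k : R).
Hypotheses (phi_ge0 : forall w, 0 <= phi w) (k_gt0 : 0 < k).
Hypothesis phi_submult : forall p v, admissible M (p ++ v) ->
  phi (p ++ v) <= k * phi p * phi v.
Hypotheses (phi_letter : forall a, phi [:: a] <= 1) (phi_nil : phi [::] = 1).
Hypothesis F_additive : almost_additive M F C.
Hypothesis F_ge : forall w, admissible M w -> - K0 <= F w.

Let C_ge0 : 0 <= C.
Proof. by have := F_additive.2 [::] [::] isT; apply: le_trans. Qed.

Let K0_ge0 : 0 <= K0.
Proof. by have := F_ge (w := [::]) isT; rewrite F_additive.1 oppr_le0. Qed.

(** If a subword has sum above [K], the whole word has sum above [C + 1]: the parts on its two sides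
    contribute at least [- K0] each, and the two joins cost [2 * C]. The remaining [C] pays for the
    join with what follows. *)
Let K := 2 * K0 + 3 * C + 1.

(** All subwords are controlled, not only prefixes, so that the rest of the word can be covered
    again after each covering word. *)
Let bounded w := forall l i r, w = l ++ i ++ r -> `|F i| <= K.

(* A shortest prefix that is not [bounded] has a subword with [F > K]; as [F] is
   bounded below, removing this prefix costs at least 1 in [F w]. *)
Let first_cut w : admissible M w -> bounded w \/
  exists y a v, [/\ w = y ++ a :: v, bounded y & F v + 1 <= F w].
Proof.
move=> adm; have [bw|nbw] := pselect (bounded w); [by left|right].
have ex : exists j, `[< ~ bounded (take j w) >].
  by exists (size w); apply/asboolP; rewrite take_size.
case: (ex_minnP ex) => -[|j] /asboolP nb jmin.
  case: nb => l i r; rewrite take0; case: l => //; case: i => // _.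
  by rewrite F_additive.1 normr0 /K; move: C_ge0 K0_ge0; lra.
have jw : (j < size w)%N by apply: jmin; apply/asboolP; rewrite take_size.
have by_ : bounded (take j w).
  apply: contrapT => nb'; have := jmin j; rewrite ltnn => H.
  by have : false by apply: H; apply/asboolP.
have [a0 _] : exists a : A, True by case: w jw {adm nbw ex nb jmin by_} => // a; exists a.
have tE := take_nth a0 jw.
exists (take j w), (nth a0 w j), (drop j.+1 w); split=> //.
  by rewrite -cat_rcons -tE cat_take_drop.
rewrite -{2}(cat_take_drop j.+1 w); rewrite -{1}(cat_take_drop j.+1 w) in adm.
have [ady adv] := cat_sorted2 adm.
have := F_additive.2 _ _ adm; rewrite ler_norml => FA.
move: nb => /existsNP[l /existsNP[i /existsNP[r /not_implyP[E]]]] /negP.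
rewrite -ltNge => Fi.
rewrite E in ady FA *.
have [adl adir] := cat_sorted2 ady; have [adi adr] := cat_sorted2 adir.
move: Fi FA (F_additive.2 _ _ ady) (F_additive.2 _ _ adir) (F_ge adl).
move: (F_ge adi) (F_ge adr) C_ge0 K0_ge0.
by rewrite /K !ler_norml lter_normr; lra.
Qed.

(** Each cut lowers [F] by at least 1 and [F] stays above [- K0], so there are at most [m] cuts. A
    bounded block loses [z ^+ N] and the letter after it [z]. *)
Lemma greedy_weight (z : R) N Ws m w : 0 <= z -> z <= 1 -> [::] \notin Ws ->
  (forall y, admissible M y -> (forall i, `|F (take i y)| <= K) ->
      (N <= size y)%N -> exists2 p, p \in Ws & prefix p y) ->
  admissible M w -> F w + K0 <= m%:R ->
  fact_weight_min phi k z Ws (z ^+ (N.+1 * m.+1) * phi w) w.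
Proof.
move=> z0 z1 W0 cov adm Fw.
have blk c y v : bounded y -> 0 <= c -> admissible M (y ++ v) ->
    fact_weight_min phi k z Ws (c * phi v) v ->
    fact_weight_min phi k z Ws (z ^+ N * c * phi (y ++ v)) (y ++ v).
  move=> by_ c0 adm' Hv; apply: (fact_weight_min_block phi_ge0 (ltW k_gt0) z0 phi_submult) => //.
  move=> l y' yE Ny; apply: cov => //.
    by move: (cat_sorted2 adm').1; rewrite yE => /cat_sorted2[].
  by move=> i; apply: (by_ l _ (drop i y')); rewrite cat_take_drop.
elim: m w adm Fw => [|m IH] w adm Fw; have [bw|] := first_cut adm.
1,3: move=> n wn; have := blk 1 w [::] bw; rewrite cats0 mulr1 phi_nil mul1r.
1,2: move=> /(_ ler01 adm) H; apply: le_trans (H _ n wn); last by case.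
1,2: by rewrite ler_wpM2r // ler_wiXn2l // (leq_trans (leqnSn N)) // leq_pmulr.
all: move=> [y [a [v [wE by_ Fv]]]]; rewrite wE in adm *.
all: have adav := (cat_sorted2 adm).2.
all: have adv : admissible M v := (@cat_sorted2 _ _ [:: a] _ adav).2.
  by exfalso; have := F_ge adv; lra.
have -> : z ^+ (N.+1 * m.+2) = z ^+ N * (z * z ^+ (N.+1 * m.+1)).
  by rewrite -exprS -exprD; rewrite mulnS addSn addnS.
apply: blk => //; first by rewrite mulr_ge0 ?exprn_ge0.
apply: (fact_weight_min_letter phi_ge0 (ltW k_gt0) z0 phi_submult) => //.
  by rewrite exprn_ge0.
by apply: IH => //; move: Fw; rewrite -natr1; lra.
Qed.

Lemma growth_one_sided : small_covers M F phi -> forall eta, 0 < eta ->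
  exists eps n0, 0 < eps /\ forall n, (n0 <= n)%N ->
    \sum_(w <- words A n | admissible M w && (F w <= eps * n%:R)) phi w
      <= expR (eta * n%:R).
Proof.
move=> cov eta eta0.
have k1 : 1 <= k.
  have := phi_submult (p := [::]) (v := [::]) isT.
  by rewrite phi_nil !mulr1.
(* With letters of weight [b^-1] and covering words of total weight at most [(2 * k)^-1], each kind
   of factor contributes at most 1/2 to [sum_fact_weight_le1]. *)
pose b : R := 2 * k * #|A|%:R + 1.
have b1 : 1 <= b by rewrite lerDr !mulr_ge0 // ltW.
have b0 : 0 < b by exact: lt_le_trans b1.
have k20 : 0 < (2 * k)^-1 by rewrite invr_gt0 mulr_gt0.
have [N [Ws [Wsum Wcov]]] := cov K _ k20.
have W0 : [::] \notin Ws.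
  (* The empty word alone has weight 1, above [(2 * k)^-1]. *)
  apply/negP => /(le_sum_seq phi_ge0); rewrite phi_nil => /le_trans/(_ Wsum).
  rewrite leNgt invf_lt1 ?mulr_gt0 //; lra.
(* The loss is [b ^+ (N.+1 * m.+1)] with [m.+1 <= 2 * eps * n] for large [n]; as [b <= expR b], it
   is at most [expR (eta * n)]. *)
pose eps := eta / (2 * b * N.+1%:R).
have D0 : 0 < 2 * b * N.+1%:R by rewrite !mulr_gt0.
exists eps, (Num.bound ((K0 + 2) / eps)); split=> [|n nn0]; first exact: divr_gt0.
have eps0 : 0 < eps by exact: divr_gt0.
have epsn : K0 + 2 <= eps * n%:R.
  rewrite -ler_pdivrMl // mulrC.
  have /archi_boundP/ltW/le_trans : 0 <= (K0 + 2) / eps.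
    by rewrite divr_ge0 ?(ltW eps0) //; move: K0_ge0; lra.
  by apply; rewrite ler_nat.
pose m := (Num.truncn (eps * n%:R + K0)).+1.
have /andP[m1 m2] : ((m.-1)%:R <= eps * n%:R + K0) && (eps * n%:R + K0 < m%:R).
  apply: truncn_itv; move: K0_ge0 epsn; lra.
rewrite -(@ler_pM2r _ ((b^-1) ^+ (N.+1 * m.+1))) ?exprn_gt0 ?invr_gt0 //.
apply: (@le_trans _ _ 1).
  rewrite mulr_suml.
  apply: le_trans (@sum_fact_weight_le1 _ _ phi k (b^-1) Ws phi_ge0 (ltW k_gt0) _ n n _).
  - rewrite big_seq_cond [leRHS]big_seq big_mkcondr /=.
    rewrite ler_sum // => w; rewrite mem_words => /eqP wn.
    case: ifP => [/andP[adm Fw]|_]; last first.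
      by rewrite fact_weight_ge0 ?(ltW k_gt0) // invr_ge0 ltW.
    rewrite mulrC; apply: (greedy_weight (N := N)) => //; rewrite ?wn //.
    + by rewrite invr_ge0 ltW.
    + by rewrite invf_le1.
    + by move: m2; lra.
  - by rewrite invr_ge0 ltW.
  - apply: (@le_trans _ _ (k * (#|A|%:R * b^-1 + (2 * k)^-1))).
      by rewrite ler_wpM2l ?(ltW k_gt0) // lerD2l.
    have -> : k * (#|A|%:R * b^-1 + (2 * k)^-1) = k * #|A|%:R / b + 2^-1.
      by field; rewrite !gt_eqF.
    rewrite -lerBrDr ler_pdivrMr // /b.
    by have := mulr_ge0 (ltW k_gt0) (ler0n R #|A|); lra.
rewrite exprVn -ler_pdivrMr ?invr_gt0 ?exprn_gt0 // invrK mul1r.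
apply: (@le_trans _ _ (expR b ^+ (N.+1 * m.+1))).
  rewrite lerXn2r ?nnegrE ?expR_ge0 ?ltW //.
  by apply: lt_le_trans (expR_ge1Dx b); rewrite ltrDr.
rewrite -expRM_natl ler_expR.
have -> : eta * n%:R = (eps * n%:R) * (2 * b * N.+1%:R).
  by rewrite /eps; field; rewrite !gt_eqF.
rewrite natrM.
have -> : N.+1%:R * m.+1%:R * b = m.+1%:R * (b * N.+1%:R) by ring.
have -> : eps * n%:R * (2 * b * N.+1%:R) = (2 * (eps * n%:R)) * (b * N.+1%:R) by ring.
rewrite ler_pM2r ?mulr_gt0 //.
by move: m1 epsn; rewrite /m /= -!natr1; lra.
Qed.

End OneSided.

(** * Sums unbounded on both sides *)

(** The connecting word depends only on the last letter of [y] and on [b], hence the uniform bound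
    on its length. *)
Lemma connecting_words (A : finType) (M : rel A) : topologically_transitive M ->
  exists l, forall y b, y != [::] -> admissible M y -> exists2 r : seq A,
    (size r <= l)%N &
    forall p, admissible M (b :: p) -> admissible M (y ++ r ++ b :: p).
Proof.
move=> trans.
have /choice[r Hr] : forall ab : A * A, exists r, admissible M (ab.1 :: rcons r ab.2).
  by move=> [a b]; have [r [_ adm]] := trans a b; exists r.
exists (\max_ab size (r ab)) => -[//|a y] b _ ady.
exists (r (last a y, b)); first exact: leq_bigmax.
move=> p adp; have := Hr (last a y, b).
move: ady adp; rewrite /admissible /= !cat_path rcons_path /=.
by move=> -> -> /andP[-> ->].
Qed.

Lemma sum_seq_le_single {R : realType} {T : eqType} (r : seq T) (P : pred T) (x0 : T)
    (c : R) : 0 <= c -> uniq r -> (forall x, x \in r -> P x -> x = x0) ->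
  \sum_(x <- r | P x) c <= c.
Proof.
move=> c0 ur Px; rewrite big_const_seq iter_addr_0 -[leRHS]mulr1n ler_wpMn2l //.
have : (count_mem x0 r <= 1)%N by rewrite count_uniq_mem ?leq_b1.
apply: leq_trans; rewrite -!size_filter; apply: uniq_leq_size; first exact: filter_uniq.
by move=> x; rewrite !mem_filter /= => /andP[Pxx xr]; rewrite (Px x xr Pxx) eqxx -(Px x xr Pxx).
Qed.

Section TwoSided.
Context {R : realType} {A : finType}.
Variables (M : rel A) (F phi : seq A -> R) (B C D : R).
Hypothesis M_trans : topologically_transitive M.
Hypothesis F_additive : almost_additive M F C.
Hypotheses (B_ge0 : 0 <= B)
  (F_le : forall w, admissible M w -> `|F w| <= B * (size w)%:R).
Hypotheses (phi_gt0 : forall w, 0 < phi w)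
  (phi_supermult : forall p v, admissible M (p ++ v) ->
    expR (- D) * (phi p * phi v) <= phi (p ++ v))
  (phi_ge : forall w, admissible M w -> expR (- (B * (size w)%:R)) <= phi w).
Hypotheses (F_unbounded_above : forall K, exists2 w, admissible M w & K < F w)
  (F_unbounded_below : forall K, exists2 w, admissible M w & F w < K).

(** Fix [p] with a large positive and [q] with a large negative sum. As long as the sum is large,
    appending the one of opposite sign lowers its absolute value by at least 1. *)
Lemma compensating_words : exists B1 a, forall y m, y != [::] ->
  admissible M y -> `|F y| <= m%:R -> exists v,
    [/\ admissible M (y ++ v), (size v <= a * m)%N & `|F (y ++ v)| <= B1].
Proof.
have [l Hl] := connecting_words M_trans.
(* [B2 - 1] is the error made in appending a word through a connecting word. *)
pose B2 := B * l%:R + 2 * C + 1.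
have C0 : 0 <= C by have := F_additive.2 [::] [::] isT; apply: le_trans.
have Bl0 : 0 <= B * l%:R by rewrite mulr_ge0.
have [p adp Fp] := F_unbounded_above B2.
have [q adq Fq] := F_unbounded_below (- B2).
have joinw y p' : y != [::] -> p' != [::] -> admissible M y -> admissible M p' ->
    exists2 r, (size r <= l)%N &
      admissible M (y ++ r ++ p') /\ `|F (y ++ r ++ p') - F y - F p'| <= B2 - 1.
  case: p' => // b p' y0 _ ady adp'; have [r rl Hr] := Hl y b y0 ady.
  exists r => //; have adm := Hr _ adp'; split=> //.
  have adr := (cat_sorted2 adm).2.
  have := F_additive.2 _ _ adm; have := F_additive.2 _ _ adr.
  have := F_le (cat_sorted2 adr).1.
  have : B * (size r)%:R <= B * l%:R by rewrite ler_wpM2l // ler_nat.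
  by rewrite /B2 !ler_norml; lra.
have p0 : p != [::] by apply: contraTneq Fp => ->; rewrite F_additive.1 /B2; lra.
have q0 : q != [::] by apply: contraTneq Fq => ->; rewrite F_additive.1 /B2; lra.
(* Above the threshold [B2 + F p - F q] adding [F p] or [F q] does not change the sign of the
   sum. *)
exists (B2 + F p - F q), (l + size p + size q)%N => y m; elim: m y => [|m IH] y y0 ady Fy.
  exists [::]; rewrite cats0; split=> //.
  by move: Fy Fp Fq; rewrite /B2 !ler_norml; lra.
have [le|] := leP `|F y| (B2 + F p - F q); first by exists [::]; rewrite cats0.
have step p' : p' != [::] -> admissible M p' -> (size p' <= size p + size q)%N ->
   `|F y + F p'| + (B2 - 1) <= m%:R -> exists v,
    [/\ admissible M (y ++ v), (size v <= (l + size p + size q) * m.+1)%N &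
      `|F (y ++ v)| <= B2 + F p - F q].
  move=> p'0 adp' sp Fm; have [r rl [adm Fr]] := joinw y p' y0 p'0 ady adp'.
  have [||v [adv sv Fv]] := IH _ _ adm.
  - by case: (y) y0.
  - apply: le_trans Fm; rewrite -lerBlDl; apply: le_trans Fr.
    by apply: le_trans (lerB_dist _ _) _; rewrite opprD addrA.
  exists (r ++ p' ++ v); rewrite -!catA in adv Fv; split=> //.
  by rewrite mulnS !size_cat addnA leq_add // -addnA leq_add.
rewrite lter_normr => /orP[] Fbig.
- by apply: (step q) => //; [exact: leq_addl|move: Fbig Fy Fp Fq;
    rewrite /B2 -natr1 -lerBrDr !ler_norml; lra].
- by apply: (step p) => //; [exact: leq_addr|move: Fbig Fy Fp Fq;
    rewrite /B2 -natr1 -lerBrDr !ler_norml; lra].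
Qed.

(** * Mass distribution on the tree of free concatenations *)

Section Mass.
Variables (n m l a : nat) (B1 K : R) (eps : R) (a0 : A).
Hypothesis F_connect : forall y, y != [::] -> admissible M y ->
  exists2 r : seq A, (size r <= l)%N &
    forall p, admissible M (a0 :: p) -> admissible M (y ++ r ++ a0 :: p).
Hypothesis F_compensate : forall y, y != [::] -> admissible M y ->
  `|F y| <= m%:R -> exists v,
    [/\ admissible M (y ++ v), (size v <= a * m)%N & `|F (y ++ v)| <= B1].
Hypotheses (m_ge : B1 + B * l%:R + eps * n%:R + 2 * C <= m%:R)
  (K_ge : B1 + C + B * (l + n + a * m)%:R <= K).

(** The first letter is fixed so that one connecting word serves all children of a node. *)
Let G w := [&& admissible M w, `|F w| <= eps * n%:R & prefix [:: a0] w].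

Definition node y := [/\ y != [::], admissible M y, `|F y| <= B1 &
  forall i, `|F (take i y)| <= K].

(** The compensating word [v w] brings the final sum back below [B1]; in between, the at most
    [l + n + a * m] added letters keep the sums below [K]. As [r] does not depend on [w], the word
    [w] sits at a fixed place in the child. *)
Lemma node_children y : node y -> exists (r : seq A) (v : seq A -> seq A),
  (size r <= l)%N /\ forall w, w \in words A n -> G w ->
    (size (v w) <= a * m)%N /\ node (y ++ r ++ w ++ v w).
Proof.
move=> [y0 ady Fy Ky]; have [r rl Hr] := F_connect y0 ady.
have C0 : 0 <= C by have := F_additive.2 [::] [::] isT; apply: le_trans.
have Br : B * (size r)%:R <= B * l%:R by rewrite ler_wpM2l // ler_nat.
have /choice[v Hv] : forall w, exists v, w \in words A n -> G w ->
    (size v <= a * m)%N /\ node (y ++ r ++ w ++ v).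
  move=> w; have [/andP[]|nG] := boolP ((w \in words A n) && G w); last first.
    by exists [::] => wn wG; case/negP: nG; rewrite wn.
  rewrite mem_words => /eqP wn /and3P[adw Fw /prefixP[w' wE]].
  have adyrw : admissible M (y ++ r ++ w) by rewrite wE; apply: (Hr w'); move: adw; rewrite wE.
  have adrw := (cat_sorted2 adyrw).2.
  have [|||v [adv sv Fv]] := F_compensate (y := y ++ r ++ w).
  - by case: (y) y0.
  - exact: adyrw.
  - apply: le_trans m_ge.
    have := F_additive.2 _ _ adyrw; have := F_additive.2 _ _ adrw.
    have := F_le (cat_sorted2 adrw).1; move: Br Fw Fy.
    by rewrite !ler_norml; lra.
  exists v => _ _; rewrite -!catA in adv Fv; split=> //; split=> //.
  - by case: (y) y0.
  - move=> i; have [iy|yi] := leqP i (size y).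
      by rewrite take_cat; case: ltnP (Ky i) => // yi;
        rewrite [take i y]take_oversize // (_ : i - _ = 0)%N ?take0 ?cats0 //;
        apply/eqP; rewrite subn_eq0.
    rewrite take_cat ltnNge (ltnW yi) /=.
    set z := take _ _.
    have adz : admissible M (y ++ z).
      by move: adv; rewrite -(cat_take_drop (i - size y)%N (r ++ w ++ v)) catA => /cat_sorted2[].
    have sz : (size z <= l + n + a * m)%N.
      have : (size z <= size (r ++ w ++ v))%N by rewrite size_take_min geq_minr.
      by move=> /leq_trans; apply; rewrite !size_cat wn addnA !leq_add.
    apply: le_trans K_ge.
    have Bz : B * (size z)%:R <= B * (l + n + a * m)%:R by rewrite ler_wpM2l // ler_nat.
    have := F_additive.2 _ _ adz; have := F_le (cat_sorted2 adz).2.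
    by move: Bz Fy; rewrite !ler_norml; lra.
by exists r, v; split.
Qed.

Variables (N : nat) (Ws : seq (seq A)).
Hypothesis cover : forall y, admissible M y -> (forall i, `|F (take i y)| <= K) ->
      (N <= size y)%N -> exists2 p, p \in Ws & prefix p y.
Hypothesis G_large : expR (3 * D + B * (l + a * m)%:R) <=
  \sum_(w <- words A n | G w) phi w.

(** Induction from long nodes to short ones. A covering word that begins a child exceeds [y] by
    boundedly many letters and suffices by itself. If there is none, the induction hypothesis
    applies to all children, whose total weight is at least [phi y] by [G_large]. *)
Lemma node_mass y : node y -> (forall p, p \in Ws -> ~~ prefix p y) ->
  expR (- (D + B * (l + n + a * m)%:R)) * phi y <=
  \sum_(p <- Ws | prefix y p) phi p.
Proof.
have [j] := ubnP (N - size y)%N; elim: j y => // j IH y Nj nody nop.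
have Ny : (size y < N)%N.
  rewrite ltnNge; apply/negP => Ny; case: nody => [_ ady _ Ky].
  by have [p /nop/negP] := cover ady Ky Ny.
have [r [v [rl Hv]]] := node_children nody.
set c1 := expR _.
pose ch w := y ++ r ++ w ++ v w.
have [[w [p [wn Gw pW pch]]]|none] := pselect (exists w p,
    [/\ w \in words A n, G w, p \in Ws & prefix p (ch w)]).
  have [sv [_ adch _ _]] := Hv w wn Gw.
  move: wn (pch); rewrite mem_words => /eqP wn /prefixP[p' chE].
  have /prefixP[q pE] : prefix y p.
    move: pch (nop p pW); rewrite /ch !prefixE.
    have [py|yp] := leqP (size p) (size y); first by rewrite takel_cat // => ->.
    move=> /eqP pE _; rewrite -{1}pE take_takel ?(ltnW yp) //.
    by rewrite take_size_cat.
  rewrite -/(ch w) chE in adch; have adp := (cat_sorted2 adch).1.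
  have sq : (size q <= l + n + a * m)%N.
    have := congr1 size chE; rewrite /ch pE -catA !size_cat wn => /addnI /esym E.
    rewrite (leq_trans (leq_addr (size p') _)) // E addnA.
    by rewrite leq_add // leq_add.
  rewrite (big_rem _ pW) /= pE prefix_prefix -pE ler_wpDr ?sumr_ge0 //.
    by move=> q' _; exact: ltW.
  rewrite pE in adp *; apply: le_trans (phi_supermult adp).
  rewrite /c1 opprD expRD -mulrA ler_wpM2l ?expR_ge0 // mulrC ler_wpM2l ?(ltW (phi_gt0 _)) //.
  apply: le_trans (phi_ge (cat_sorted2 adp).2).
  by rewrite ler_expR lerN2 ler_wpM2l // ler_nat.
(* A covering word extending a child determines [w], so it is counted for one child only. *)
have chP w p : w \in words A n -> prefix (ch w) p ->
    w = take n (drop (size (y ++ r)) p).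
  rewrite mem_words => /eqP wn /prefixP[p' ->].
  by rewrite /ch -!catA catA drop_size_cat // take_size_cat.
apply: (@le_trans _ _ (\sum_(w <- words A n | G w)
    \sum_(p <- Ws | prefix (ch w) p) phi p)); last first.
  rewrite (exchange_big_dep (fun p => prefix y p)) /=; last first.
    by move=> w p _ /prefixP[p' ->]; rewrite /ch -!catA prefix_prefix.
  apply: ler_sum => p yp.
  apply: (sum_seq_le_single (x0 := take n (drop (size (y ++ r)) p))).
  - exact: ltW.
  - exact: words_uniq.
  - by move=> w wn /andP[_]; exact: chP.
apply: (@le_trans _ _ (\sum_(w <- words A n | G w) c1 * phi (ch w))); last first.
  rewrite big_seq_cond [leRHS]big_seq_cond ler_sum // => w /andP[wn Gw].
  have [sv nodch] := Hv w wn Gw.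
  apply: IH => //.
    move: wn Gw nodch; rewrite mem_words => /eqP wn /and3P[_ _ /prefixP[w' wE]] _.
    apply: (@leq_trans (N - size y)); last by rewrite -ltnS.
    rewrite /ch !size_cat ltn_sub2l //.
    by rewrite wE /= -[ltnLHS]addn0 ltn_add2l addnC.
  by move=> p pW; apply/negP => pch; apply: none; exists w, p.
rewrite -mulr_sumr ler_wpM2l ?expR_ge0 //.
rewrite -[leLHS]mulr1.
have E0 : 0 < expR (- (3 * D + B * (l + a * m)%:R)) :> R by exact: expR_gt0.
(* The exponent accounts for the three joins in [y ++ r ++ w ++ v w] and for the weights of [r] and
   [v w]. *)
apply: (@le_trans _ _ (phi y * (expR (- (3 * D + B * (l + a * m)%:R)) *
   \sum_(w <- words A n | G w) phi w))).
  rewrite ler_wpM2l ?(ltW (phi_gt0 _)) // -ler_pdivrMl // -expRN opprK mulr1 //.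
rewrite !mulr_sumr big_seq_cond [leRHS]big_seq_cond ler_sum // => w /andP[wn Gw].
have [sv [_ adch _ _]] := Hv w wn Gw.
have adrwv := (cat_sorted2 adch).2; have adwv := (cat_sorted2 adrwv).2.
have adr := (cat_sorted2 adrwv).1; have adv := (cat_sorted2 adwv).2.
apply: le_trans (phi_supermult adch).
rewrite [leRHS]mulrCA ler_wpM2l ?(ltW (phi_gt0 _)) //.
apply: le_trans (ler_wpM2l (expR_ge0 _) (phi_supermult adrwv)).
apply: le_trans (ler_wpM2l (expR_ge0 _) (ler_wpM2l (expR_ge0 _)
   (ler_wpM2l (ltW (phi_gt0 _)) (phi_supermult adwv)))).
have -> : expR (- (3 * D + B * (l + a * m)%:R)) =
    expR (- D) * (expR (- D) * (expR (- (B * l%:R)) * (expR (- D) *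
      expR (- (B * (a * m)%:R))))).
  by rewrite -!expRD; congr expR; rewrite natrD; ring.
rewrite -!mulrA !ler_wpM2l ?expR_ge0 //.
rewrite ler_pM ?mulr_ge0 ?expR_ge0 ?(ltW (phi_gt0 _)) //.
  apply: le_trans (phi_ge adr).
  by rewrite ler_expR lerN2 ler_wpM2l // ler_nat.
rewrite ler_wpM2l ?expR_ge0 // mulrC ler_wpM2l ?(ltW (phi_gt0 _)) //.
apply: le_trans (phi_ge adv).
by rewrite ler_expR lerN2 ler_wpM2l // ler_nat.
Qed.

End Mass.

(** Otherwise the tree rooted at the word [[:: a0]] exists, and [node_mass] bounds the weight of its
    covers away from zero. *)
Lemma sum_good_words_lt (n m l a : nat) (B1 eps : R) (a0 : A) :
  (forall y, y != [::] -> admissible M y ->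
    exists2 r : seq A, (size r <= l)%N &
      forall p, admissible M (a0 :: p) -> admissible M (y ++ r ++ a0 :: p)) ->
  (forall y, y != [::] -> admissible M y -> `|F y| <= m%:R -> exists v,
    [/\ admissible M (y ++ v), (size v <= a * m)%N & `|F (y ++ v)| <= B1]) ->
  B <= B1 -> B1 + B * l%:R + eps * n%:R + 2 * C <= m%:R ->
  small_covers M F phi ->
  \sum_(w <- words A n | [&& admissible M w, `|F w| <= eps * n%:R
    & prefix [:: a0] w]) phi w < expR (3 * D + B * (l + a * m)%:R).
Proof.
move=> connect compensate BB1 m_ge cov; rewrite ltNge; apply/negP => large.
have C0 : 0 <= C by have := F_additive.2 [::] [::] isT; apply: le_trans.
pose K := B1 + C + B * (l + n + a * m)%:R.
pose c1 : R := expR (- (D + B * (l + n + a * m)%:R)).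
(* The first term contradicts [node_mass]; the other two keep the prefixes of the root out of
   [Ws]. *)
pose del := Num.min (c1 * phi [:: a0]) (Num.min (phi [:: a0]) (phi [::])) / 2.
have min0 : 0 < Num.min (c1 * phi [:: a0]) (Num.min (phi [:: a0]) (phi [::])).
  by rewrite !lt_min !phi_gt0 mulr_gt0 ?expR_gt0.
have del0 : 0 < del by rewrite divr_gt0.
have [N [Ws [Wsum cover]]] := cov K del del0.
have : del < Num.min (c1 * phi [:: a0]) (Num.min (phi [:: a0]) (phi [::])).
  by rewrite /del; lra.
rewrite !lt_min => /and3P[del1 del2 del3].
have FB : `|F [:: a0]| <= B by have := F_le (w := [:: a0]) isT; rewrite mulr1.
have root : node B1 K [:: a0].
  split=> //; first exact: le_trans FB BB1.
  move=> i; apply: (@le_trans _ _ B); last first.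
    have : 0 <= B * (l + n + a * m)%:R by rewrite mulr_ge0.
    by rewrite /K; lra.
  by case: i => [|i] //=; rewrite F_additive.1 normr0.
have notp p : p \in Ws -> ~~ prefix p [:: a0].
  move=> /(le_sum_seq (fun q => ltW (phi_gt0 q)))/le_trans/(_ Wsum) pdel.
  case: p pdel => [|b [|b' p]]; rewrite ?prefix_cons //=.
  - by rewrite leNgt del3.
  - rewrite andbT; case: eqP => // ->.
    by rewrite leNgt del2.
  - by rewrite andbF.
have := node_mass connect compensate m_ge (lexx K) cover large root notp.
rewrite -/c1 => /(lt_le_trans del1); apply/negP; rewrite -leNgt.
apply: le_trans Wsum; rewrite [leRHS](bigID (prefix [:: a0])) /= lerDl.
by rewrite sumr_ge0 // => p _; exact: ltW.
Qed.

Lemma growth_two_sided : small_covers M F phi -> forall eta, 0 < eta ->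
  exists eps n0, 0 < eps /\ forall n, (n0 <= n)%N ->
    \sum_(w <- words A n | admissible M w && (`|F w| <= eps * n%:R)) phi w
      <= expR (eta * n%:R).
Proof.
move=> cov eta eta0.
have C0 : 0 <= C by have := F_additive.2 [::] [::] isT; apply: le_trans.
have [l connect] := connecting_words M_trans.
have [B0 [a comp]] := compensating_words.
(* The maximum with [B] makes one-letter words nodes. *)
pose B1 := Num.max B0 B.
have compensate y m : y != [::] -> admissible M y -> `|F y| <= m%:R -> exists v,
    [/\ admissible M (y ++ v), (size v <= a * m)%N & `|F (y ++ v)| <= B1].
  move=> y0 ady /(comp y m y0 ady)[v [adv sv Fv]]; exists v; split=> //.
  by rewrite le_max Fv.
pose c2 := B1 + B * l%:R + 2 * C.
(* [c0] collects the part of the final exponent independent of [n]; the choice of [eps] bounds the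
   rest by half of [eta * n]. *)
pose c0 := #|A|%:R + 3 * D + B * l%:R + B * a%:R * (c2 + 1).
pose eps := eta / (2 * (B * a%:R + 1)).
have Ba0 : 0 <= B * a%:R by rewrite mulr_ge0.
have eps0 : 0 < eps by rewrite divr_gt0 // mulr_gt0 // ltr_wpDl.
have c20 : 0 <= c2 by rewrite !addr_ge0 ?mulr_ge0 // le_max B_ge0 orbT.
(* The successor makes [n] positive, so that words of length [n] have a first letter. *)
exists eps, (Num.bound `|2 * c0 / eta|).+1; split=> // n nn0.
have n_ge : c0 <= eta / 2 * n%:R.
  rewrite -ler_pdivrMl ?divr_gt0 // invf_div mulrC mulrCA mulrA.
  apply: le_trans (ler_norm _) _; apply/ltW/(lt_le_trans (archi_boundP (normr_ge0 _))).
  by rewrite ler_nat ltnW.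
pose m := (Num.truncn (c2 + eps * n%:R)).+1.
have cn0 : 0 <= c2 + eps * n%:R by rewrite addr_ge0 // mulr_ge0 // ltW.
have /andP[m1 m2] := truncn_itv cn0; rewrite -/m in m2.
have key a0 : \sum_(w <- words A n | [&& admissible M w, `|F w| <= eps * n%:R
    & prefix [:: a0] w]) phi w <= expR (3 * D + B * (l + a * m)%:R).
  apply/ltW/(@sum_good_words_lt _ _ _ _ B1) => //.
  - by move=> y y0 ady; exact: connect.
  - by move=> y y0 ady; exact: compensate.
  - by rewrite le_max lexx orbT.
  - by move: m2; rewrite /c2; lra.
apply: (@le_trans _ _ (\sum_(a0 : A) \sum_(w <- words A n |
   [&& admissible M w, `|F w| <= eps * n%:R & prefix [:: a0] w]) phi w)).
  rewrite (exchange_big_dep (fun w => admissible M w && (`|F w| <= eps * n%:R))) /=.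
    rewrite big_seq_cond [leRHS]big_seq_cond ler_sum // => -[|b w].
      by rewrite mem_words /= => /andP[/eqP n0E]; move: nn0; rewrite -n0E.
    move=> /andP[_ /andP[-> ->]] /=; rewrite (bigD1 b) ?eqxx ?prefix0s //=.
    by rewrite lerDl sumr_ge0 // => ? _; exact: ltW.
  by move=> a0 w _ /and3P[-> ->].
apply: le_trans (ler_sum _ (fun a0 _ => key a0)) _.
rewrite sumr_const -[leLHS]mulr_natl.
apply: (@le_trans _ _ (expR #|A|%:R * expR (3 * D + B * (l + a * m)%:R))).
  rewrite ler_wpM2r ?expR_ge0 //; apply: le_trans (expR_ge1Dx _).
  by rewrite lerDr.
rewrite -expRD ler_expR natrD natrM.
have mle : m%:R <= c2 + eps * n%:R + 1 by rewrite /m -natr1; lra.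
have Bam : B * a%:R * m%:R <= B * a%:R * (c2 + eps * n%:R + 1) by rewrite ler_wpM2l.
have Bae : B * a%:R * (eps * n%:R) <= eta / 2 * n%:R.
  have E : eps * (B * a%:R + 1) = eta / 2.
    by rewrite /eps; field; rewrite gt_eqF // ltr_wpDl.
  by rewrite mulrA ler_wpM2r //; move: E eps0; lra.
move: n_ge Bam Bae; rewrite /c0; lra.
Qed.

End TwoSided.

(** * Birkhoff sums *)

Lemma growth {R : realType} {A : finType} (M : rel A) (F phi : seq A -> R)
    (B C D : R) :
  topologically_transitive M -> almost_additive M F C -> 0 <= B ->
  (forall w, admissible M w -> `|F w| <= B * (size w)%:R) ->
  (forall w, 0 < phi w) -> phi [::] = 1 -> (forall a, phi [:: a] <= 1) ->
  (forall p v, admissible M (p ++ v) ->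
    expR (- D) * (phi p * phi v) <= phi (p ++ v) /\
    phi (p ++ v) <= expR D * phi p * phi v) ->
  (forall w, admissible M w -> expR (- (B * (size w)%:R)) <= phi w) ->
  small_covers M F phi -> forall eta, 0 < eta ->
  exists eps n0, 0 < eps /\ forall n, (n0 <= n)%N ->
    \sum_(w <- words A n | admissible M w && (`|F w| <= eps * n%:R)) phi w
      <= expR (eta * n%:R).
Proof.
move=> trans Fadd B0 FB phi0 phi_nil phi_letter phiM phi_ge cov eta eta0.
have phi_ge0 w := ltW (phi0 w).
(* Used with [G = F] if [F] is bounded below and with [G = - F] if it is bounded above. *)
have one_sided G : almost_additive M G C -> (forall w, `|F w| = `|G w|) ->
    (exists K, forall w, admissible M w -> K <= G w) ->
  exists eps n0, 0 < eps /\ forall n, (n0 <= n)%N ->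
    \sum_(w <- words A n | admissible M w && (`|F w| <= eps * n%:R)) phi w
      <= expR (eta * n%:R).
  move=> Gadd GF [K HK].
  have HK' w : admissible M w -> - - K <= G w by rewrite opprK; exact: HK.
  have covG : small_covers M G phi.
    move=> K' delta delta0; have [N [Ws [? H]]] := cov K' delta delta0.
    exists N, Ws; split=> // y ady Ky; apply: H => // i.
    by rewrite GF.
  have [eps [n0 [eps0 Hn]]] := growth_one_sided phi_ge0 (expR_gt0 D)
    (fun p v adm => (phiM p v adm).2) phi_letter phi_nil Gadd HK' covG eta0.
  exists eps, n0; split=> // n /Hn; apply: le_trans.
  rewrite big_mkcond [leRHS]big_mkcond ler_sum // => w _.
  case: ifP => [/andP[adm Fw]|_]; last first.
    by case: ifP => // _; exact: phi_ge0.
  have -> : G w <= eps * n%:R by rewrite (le_trans (ler_norm _)) -?GF.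
  by rewrite adm lexx.
have [above|] := pselect (forall K, exists2 w, admissible M w & K < F w); last first.
  move=> /existsNP[K HK]; apply: (one_sided (fun w => - F w)).
  - split; first by rewrite Fadd.1 oppr0.
    by move=> w v adm; rewrite -!opprD normrN; exact: Fadd.2.
  - by move=> w; rewrite normrN.
  - exists (- K) => w adm; rewrite lerN2 leNgt; apply/negP => Fw.
    by apply: HK; exists w.
have [below|] := pselect (forall K, exists2 w, admissible M w & F w < K); last first.
  move=> /existsNP[K HK]; apply: (one_sided F) => //.
  exists K => w adm; rewrite leNgt; apply/negP => Fw.
  by apply: HK; exists w.
exact: (growth_two_sided trans Fadd B0 FB phi0 (fun p v adm => (phiM p v adm).1)).
Qed.

(** * Distortion of Birkhoff sums on cylinders *)

Section Birkhoff.
Context {R : realType} {A : finType}.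
Variable M : rel A.
Implicit Types (f g : Sigma M -> R) (xi eta : Sigma M) (w : seq A).

Local Notation block xi n := (mkseq (val xi) n).

Lemma val_iter_sigma k xi n : val (iter k (@sigma A M) xi) n = val xi (k + n)%N.
Proof. by elim: k n => [|k IH] n //=; rewrite IH addSnnS. Qed.

Lemma birkhoff_sumD m n f xi : birkhoff_sum (m + n) f xi =
  birkhoff_sum m f xi + birkhoff_sum n f (iter m (@sigma A M) xi).
Proof.
rewrite /birkhoff_sum (big_cat_nat (n := m)) ?leq_addr //=; congr (_ + _).
rewrite -{1}[m]add0n big_addn addKn; apply: eq_bigr => k _.
by rewrite iterD.
Qed.

Lemma eq_block_le xi eta m n : (m <= n)%N -> block xi n = block eta n ->
  block xi m = block eta m.
Proof.
move=> mn E; apply: (@eq_from_nth _ (val xi 0%N)); rewrite ?size_mkseq // => i im.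
have := congr1 (fun s => nth (val xi 0%N) s i) E.
by rewrite /= !nth_mkseq // (leq_trans im).
Qed.

Lemma eq_blockP xi eta n :
  block xi n = block eta n <-> forall i, (i < n)%N -> val xi i = val eta i.
Proof.
split=> [E i lt|E].
  have := congr1 (fun s => nth (val xi 0%N) s i) E.
  by rewrite /= !nth_mkseq.
by apply/eq_in_map => i; rewrite mem_iota => /andP[_]; exact: E.
Qed.

Lemma block_cat xi m n :
  block xi (m + n) = block xi m ++ block (iter m (@sigma A M) xi) n.
Proof.
rewrite /mkseq iotaD map_cat add0n; congr (_ ++ _).
rewrite -{1}[m]addn0 iotaDl -map_comp; apply: eq_map => i /=.
by rewrite val_iter_sigma.
Qed.

Lemma common_lengthP xi eta : xi <> eta ->
  [/\ val xi (common_length xi eta) <> val eta (common_length xi eta) &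
      forall n, block xi n = block eta n <-> (n <= common_length xi eta)%N].
Proof.
rewrite /common_length => neq; case: pselect => [ex|nex]; last first.
  case: neq; apply/val_inj/funext => n.
  by apply: contrapT => /eqP ne; apply: nex; exists n.
case: ex_minnP => m /eqP m1 m2; split=> // n; rewrite eq_blockP; split=> [E|nm i im].
  by rewrite leqNgt; apply/negP => mn; apply: m1; exact: E.
apply/eqP; apply: contraTT im => /m2; rewrite -leqNgt; exact: leq_trans.
Qed.

Lemma admissible_block xi n : admissible M (block xi n).
Proof.
apply/(sortedP (val xi 0%N)) => i; rewrite size_mkseq => lt.
by rewrite !nth_mkseq ?(ltnW lt) //; have := set_mem (valP xi); exact.
Qed.

Lemma cylinder_mkseq (x : nat -> A) n xi :
  cylinder (mkseq x n) xi = (block xi n = mkseq x n).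
Proof. by rewrite /cylinder /= size_mkseq. Qed.

Lemma cylinder_block xi n : cylinder (block xi n) xi.
Proof. by rewrite cylinder_mkseq. Qed.

Lemma cylinder_exists w : (forall a, exists b, M a b) -> (0 < #|A|)%N ->
  admissible M w -> exists xi : Sigma M, cylinder w xi.
Proof.
move=> /choice[next Hnext] /card_gt0P[a0 _] adw.
(* The default value of [nth] varies with [n]: past the end of [w] it iterates [next] from the last
   letter. *)
pose x n := nth (iter (n.+1 - size w) next (last a0 w)) w n.
have xS : x \in Sigma M.
  apply/mem_set => n; rewrite /x.
  have [lt|] := ltnP n.+1 (size w).
    rewrite (set_nth_default a0) 1?ltnW // [X in M _ X](set_nth_default a0) //.
    by move/sortedP: adw; apply.
  rewrite leq_eqVlt => /orP[/eqP sw|lt].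
    rewrite [X in M _ X]nth_default -?sw // subSn // subnn.
    rewrite (set_nth_default a0) -?sw //.
    have -> : n = (size w).-1 by rewrite sw.
    by rewrite nth_last; exact: Hnext.
  rewrite !nth_default // 1?ltnW // [(n.+2 - _)%N]subSn 1?ltnW //; exact: Hnext.
exists (SigSub xS); rewrite /cylinder /=.
apply: (@eq_from_nth _ a0); rewrite size_mkseq // => i lt.
by rewrite nth_mkseq // /x; exact: set_nth_default.
Qed.

(* One constant serves as distortion bound and as uniform bound. *)
Definition regular f C := [/\ 0 <= C, forall xi, `|f xi| <= C &
  forall n xi eta, block xi n = block eta n ->
    `|birkhoff_sum n f xi - birkhoff_sum n f eta| <= C].

Lemma hoelder_block f : hoelder_continuous f -> exists e C, [/\ 0 < e, 0 <= C &
  forall n xi eta, block xi n = block eta n ->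
    `|f xi - f eta| <= C * expR (- e) ^+ n].
Proof.
move=> [e [C [e0 H]]]; exists e, `|C|; split=> // n xi eta E.
apply: le_trans (H xi eta) _.
rewrite (le_trans (ler_norm _)) // normrM ler_wpM2l //.
rewrite ger0_norm ?powR_ge0 // /d1; case: pselect => [xieta|neq].
  by rewrite powR0 ?gt_eqF // exprn_ge0 // expR_ge0.
rewrite size_mkseq -expRM -expRM_natl ler_expR mulNr mulrN lerN2.
by rewrite ler_wpM2r ?(ltW e0) // ler_nat; apply/(common_lengthP neq).2.
Qed.

Lemma hoelder_regular f : hoelder_continuous f -> exists C, regular f C.
Proof.
move=> /hoelder_block[e [C [e0 C0 H]]].
set q := expR (- e) in H.
have q0 : 0 <= q by exact: expR_ge0.
have q1 : q < 1 by rewrite /q expR_lt1 oppr_lt0.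
have [B B0 HB] : exists2 B, 0 <= B & forall xi, `|f xi| <= B.
  have [[xi0 _]|nex] := pselect (exists xi : Sigma M, True); last first.
    by exists 0 => // xi; case: nex; exists xi.
  exists (`|f xi0| + C) => [|xi]; first by rewrite addr_ge0.
  have := H 0%N xi xi0 erefl; rewrite expr0 mulr1 => le.
  by rewrite -lerBlDl; apply: le_trans le; exact: lerB_dist.
have D0 : 0 <= C / (1 - q) by rewrite divr_ge0 // subr_ge0 ltW.
exists (B + C / (1 - q)); split=> [|xi|n xi eta E].
- by rewrite addr_ge0.
- by rewrite (le_trans (HB xi)) // lerDl.
(* The exact geometric sum is kept, so that the induction closes. *)
suff : `|birkhoff_sum n f xi - birkhoff_sum n f eta| <= C / (1 - q) * (1 - q ^+ n).
  move=> /le_trans; apply; rewrite (le_trans (_ : _ <= C / (1 - q))) ?lerDr //.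
  by rewrite ler_piMr // gerDl oppr_le0 exprn_ge0.
elim: n xi eta E => [|n IH] xi eta E.
  by rewrite /birkhoff_sum !big_geq // subrr normr0 expr0 subrr mulr0.
rewrite -[n.+1]add1n !birkhoff_sumD /birkhoff_sum !big_nat1 /=.
have En : block (iter 1 (@sigma A M) xi) n = block (iter 1 (@sigma A M) eta) n.
  apply/eq_blockP => i lt; rewrite !val_iter_sigma.
  by move/eq_blockP: E; apply; rewrite add1n.
have := IH _ _ En; have := H _ _ _ E; rewrite /birkhoff_sum /=.
set a := f xi; set b := f eta; set c := \sum_(_ <= _ < _) _; set d := \sum_(_ <= _ < _) _.
move=> ab cd; have -> : a + c - (b + d) = (a - b) + (c - d) by ring.
apply: le_trans (ler_normD _ _) _; apply: le_trans (lerD ab cd) _.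
have -> : C / (1 - q) * (1 - q ^+ (1 + n)) =
   C * q ^+ n + C / (1 - q) * (1 - q ^+ n).
  by rewrite exprS; field; rewrite gt_eqF // subr_gt0.
by rewrite lerD2r ler_wpM2l // exprS ler_piMl ?exprn_ge0 // ltW.
Qed.

(** Compactness through [fan]: around a point [xi], [f] is at least [f xi / 2] on a cylinder, and an
    inadmissible sequence has a prefix with empty cylinder. *)
Lemma hoelder_gt0_bound f : hoelder_continuous f -> (forall xi, 0 < f xi) ->
  exists2 c, 0 < c & forall xi, c <= f xi.
Proof.
move=> /hoelder_block[e [C [e0 C0 H]]] f0.
have [|N HN] := @fan A (fun k w => forall xi, cylinder w xi -> k.+1%:R^-1 <= f xi).
  move=> x; have [xS|/existsNP[n nM]] := pselect (forall n, M (x n) (x n.+1)); last first.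
    exists n.+2, 0%N => xi; rewrite cylinder_mkseq => E; case: nM.
    have xE i : (i < n.+2)%N -> x i = val xi i.
      move=> lt; have := congr1 (fun s => nth (x 0%N) s i) E.
      by rewrite !nth_mkseq.
    by rewrite !xE //; exact: set_mem (valP xi) n.
  pose xi : Sigma M := SigSub (mem_set xS).
  have fx2 : 0 < f xi / 2 by rewrite divr_gt0.
  pose k := Num.bound (f xi / 2)^-1.
  pose n := Num.bound (C / (e * (f xi / 2))).
  exists n, k => eta; rewrite cylinder_mkseq => E.
  have k_lt : k.+1%:R^-1 <= f xi / 2.
    rewrite invf_ple ?posrE // ltW // (lt_trans (archi_boundP _)) ?ltr_nat //.
    by rewrite invr_ge0 ltW.
  have n_lt : C * expR (- e) ^+ n <= f xi / 2.
    rewrite -expRM_natl mulrN expRN ler_pdivrMr ?expR_gt0 //.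
    have e2 : 0 < e * (f xi / 2) by rewrite mulr_gt0.
    have /archi_boundP/ltW : 0 <= C / (e * (f xi / 2)) by rewrite divr_ge0 // ltW.
    rewrite -/n ler_pdivrMr // => /le_trans; apply.
    rewrite mulrA mulrC ler_wpM2l ?(ltW fx2) //.
    by apply: le_trans (expR_ge1Dx _); rewrite lerDr.
  have := le_trans (H n eta xi E) n_lt; rewrite ler_norml => /andP[+ _].
  by move: k_lt; set k1 := _^-1; lra.
exists N.+1%:R^-1 => [|xi]; first by rewrite invr_gt0.
have [|n [k [nN kN]]] := HN (block xi N); first by rewrite size_mkseq.
move=> /(_ xi) Hk; apply: le_trans (Hk _); last first.
  rewrite size_mkseq in nN; rewrite -(subnKC nN) block_cat take_size_cat ?size_mkseq //.
  exact: cylinder_block.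
by rewrite lef_pV2 ?posrE // ler_nat ltnS ltnW.
Qed.

Lemma birkhoff_sum_le f B n xi : (forall eta, `|f eta| <= B) ->
  `|birkhoff_sum n f xi| <= B * n%:R.
Proof.
move=> HB; apply: le_trans (ler_norm_sum _ _ _) _.
apply: le_trans (ler_sum _ (fun k _ => HB _)) _.
by rewrite sumr_const_nat subn0 mulr_natr.
Qed.

Lemma birkhoff_sum_ge f c n xi : (forall eta, c <= f eta) ->
  c * n%:R <= birkhoff_sum n f xi.
Proof.
move=> Hc; apply: le_trans (ler_sum _ (fun k _ => Hc _)).
by rewrite sumr_const_nat subn0 mulr_natr.
Qed.

Lemma regularB f g C D (a : R) : regular f C -> regular g D ->
  regular (fun xi => f xi - a * g xi) (C + `|a| * D).
Proof.
move=> [C0 fC fd] [D0 gD gd]; split.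
- by rewrite addr_ge0 // mulr_ge0.
- move=> xi; apply: le_trans (ler_normB _ _) _.
  by rewrite lerD // normrM ler_wpM2l.
- move=> n xi eta E.
  have S zeta : birkhoff_sum n (fun xi => f xi - a * g xi) zeta =
     birkhoff_sum n f zeta - a * birkhoff_sum n g zeta.
    by rewrite /birkhoff_sum sumrB mulr_sumr.
  rewrite !S; apply: (@le_trans _ _ (`|(birkhoff_sum n f xi - birkhoff_sum n f eta) -
     a * (birkhoff_sum n g xi - birkhoff_sum n g eta)|)).
    by rewrite le_eqVlt; apply/orP; left; apply/eqP; congr `|_|; ring.
  apply: le_trans (ler_normB _ _) _.
  by rewrite lerD ?fd // normrM ler_wpM2l // gd.
Qed.

(** Substitute for the supremum over the cylinder: for regular [f] and admissible [w] the two differ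
    by at most the distortion. *)
Definition word_sum (rep : seq A -> Sigma M) f w :=
  birkhoff_sum (size w) f (rep w).

Lemma representatives_exist : (forall a, exists b, M a b) -> (0 < #|A|)%N ->
  exists rep : seq A -> Sigma M,
    forall w, admissible M w -> cylinder w (rep w).
Proof.
move=> follow A0; have [xi0 _] := cylinder_exists follow A0 (w := [::]) isT.
suff /choice[rep Hrep] : forall w, exists xi : Sigma M,
    admissible M w -> cylinder w xi.
  by exists rep.
move=> w; have [adm|nadm] := boolP (admissible M w); last by exists xi0.
by have [xi] := cylinder_exists follow A0 adm; exists xi.
Qed.

Section WordSum.
Variables (rep : seq A -> Sigma M) (f : Sigma M -> R) (C : R).
Hypothesis repP : forall w, admissible M w -> cylinder w (rep w).
Hypothesis f_reg : regular f C.

Lemma cylinder_admissible w xi : cylinder w xi -> admissible M w.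
Proof. by move=> <-; exact: admissible_block. Qed.

Lemma word_sum_dist w xi : cylinder w xi ->
  `|birkhoff_sum (size w) f xi - word_sum rep f w| <= C.
Proof.
move=> wxi; have [_ _ fd] := f_reg; apply: fd.
rewrite wxi; apply/esym/repP; exact: cylinder_admissible wxi.
Qed.

Lemma word_sum_additive : almost_additive M (word_sum rep f) (2 * C).
Proof.
split=> [|w v adm]; first by rewrite /word_sum /birkhoff_sum big_geq.
have := repP adm; rewrite /cylinder /= size_cat block_cat => /eqP.
rewrite eqseq_cat ?size_mkseq // => /andP[/eqP E1 /eqP E2].
have := word_sum_dist E1; have := word_sum_dist E2.
rewrite {3}/word_sum size_cat birkhoff_sumD !ler_norml; lra.
Qed.

Lemma word_sum_le w : `|word_sum rep f w| <= C * (size w)%:R.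
Proof. by apply: birkhoff_sum_le; case: f_reg. Qed.

End WordSum.

End Birkhoff.

(** * Hausdorff measure *)

Lemma sum_sub_uniq {R : realType} {T : eqType} (r1 r2 : seq T) (g : T -> R) :
  (forall x, 0 <= g x) -> uniq r1 -> {subset r1 <= r2} ->
  \sum_(x <- r1) g x <= \sum_(x <- r2) g x.
Proof.
move=> g0; elim: r1 r2 => [|x r1 IH] r2 /=; first by rewrite big_nil sumr_ge0.
move=> /andP[xr1 ur1] sub; rewrite big_cons [leRHS](big_rem x) ?sub ?mem_head //=.
rewrite lerD2l IH // => y yr1; apply: contraT => yr2.
have : y \in r2 by rewrite sub // inE yr1 orbT.
have xr2 : x \in r2 by rewrite sub ?mem_head.
rewrite (perm_mem (perm_to_rem xr2)) inE (negbTE yr2) orbF => /eqP yx.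
by rewrite yx (negbTE xr1) in yr1.
Qed.

(** Covers are sequences of sets, so words are enumerated by their codes; this passes to sums
    ordered by length. *)
Lemma sum_pickle_words {R : realType} {A : finType} (g : seq A -> R) m :
  (forall w, 0 <= g w) -> exists n,
  \sum_(0 <= k < m) oapp g 0 (pickle_inv k) <=
    \sum_(0 <= i < n) \sum_(w <- words A i) g w.
Proof.
move=> g0; rewrite -(@big_pmap R 0 _ _ _ (@pickle_inv _)) /=.
set r := pmap _ _.
exists (\max_(w <- r) size w).+1.
rewrite -(big_map (words A) xpredT (fun s => \sum_(w <- s) g w)) -big_flatten.
apply: sum_sub_uniq => //.
  exact: (pmap_uniq (@pickle_invK _)) (iota_uniq _ _).
move=> w wr; apply/flatten_mapP; exists (size w).
  by rewrite mem_iota subn0 add0n ltnS (leq_bigmax_seq (F := size)).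
by rewrite mem_words.
Qed.

Lemma geometric_tail {R : realType} (q : R) N n : 0 <= q -> q < 1 ->
  \sum_(0 <= i < n) (if (N <= i)%N then q ^+ i else 0) <= q ^+ N / (1 - q).
Proof.
move=> q0 q1; have q1' : 0 < 1 - q by rewrite subr_gt0.
(* Adding the remaining tail makes the induction on [n] telescope. *)
suff : \sum_(0 <= i < n) (if (N <= i)%N then q ^+ i else 0) +
    q ^+ (maxn n N) / (1 - q) <= q ^+ N / (1 - q).
  by apply: le_trans; rewrite lerDl divr_ge0 ?exprn_ge0 // ltW.
elim: n => [|n IH]; first by rewrite big_geq // max0n add0r.
rewrite big_nat_recr //=; apply: le_trans IH; rewrite -addrA lerD2l.
case: ifPn => [Nn|]; last rewrite -ltnNge => nN.
  rewrite (maxn_idPl Nn) (maxn_idPl (leqW Nn)) exprS le_eqVlt; apply/orP; left.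
  by apply/eqP; field; rewrite gt_eqF.
by rewrite add0r (maxn_idPr nN) (maxn_idPr (ltnW nN)).
Qed.

Section HausdorffZero.
Context {R : realType} {T : Type}.
Variable d : T -> T -> R.

Lemma diameter_pow_ge0 s (U : set T) : (0 <= diameter_pow d s U)%E.
Proof. by rewrite /diameter_pow; case: ifP => // _; exact: poweR_ge0. Qed.

Lemma hausdorff_content_ge0 s delta (E : set T) :
  (0 <= hausdorff_content d s delta E)%E.
Proof.
apply: le_ereal_inf_tmp => _ [U _ <-].
by apply: nneseries_ge0 => k _ _; exact: diameter_pow_ge0.
Qed.

Lemma hausdorff_measure_ge0 s (E : set T) : (0 <= hausdorff_measure d s E)%E.
Proof.
apply: le_ereal_sup_tmp; exists (hausdorff_content d s 1 E).
  by exists 1 => //=; exact: ltr01.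
exact: hausdorff_content_ge0.
Qed.

Lemma hausdorff_measure_eq0P s (E : set T) : hausdorff_measure d s E = 0%E <->
  forall delta e, 0 < delta -> 0 < e -> exists U : nat -> set T,
    [/\ E `<=` \bigcup_k U k, forall k, (diameter d (U k) <= delta%:E)%E &
      (\sum_(0 <= k <oo) diameter_pow d s (U k) < e%:E)%E].
Proof.
split=> [H0 delta e delta0 e0|H].
  have : (hausdorff_content d s delta E < e%:E)%E.
    apply: (@le_lt_trans _ _ 0%E); last by rewrite lte_fin.
    by rewrite -H0; apply: ereal_sup_ubound; exists delta.
  by move=> /ereal_inf_lt[_ [U [EU dU] <-] lt]; exists U.
apply/eqP; rewrite eq_le hausdorff_measure_ge0 andbT.
apply: ge_ereal_sup => _ [delta delta0 <-].
apply/lee_addgt0Pr => e e0; rewrite add0e.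
have [U [EU dU lt]] := H delta e delta0 e0.
by apply: ge_ereal_inf; exists (\sum_(0 <= k <oo) diameter_pow d s (U k))%E;
  [exists U|exact: ltW].
Qed.

Lemma hausdorff_measure_eq0_sub s (E E' : set T) : E `<=` E' ->
  hausdorff_measure d s E' = 0%E -> hausdorff_measure d s E = 0%E.
Proof.
move=> sub /hausdorff_measure_eq0P H; apply/hausdorff_measure_eq0P => delta e d0 e0.
have [U [EU dU lt]] := H delta e d0 e0; exists U; split=> //.
exact: subset_trans EU.
Qed.

End HausdorffZero.

(** * Cylinders and the metric [du u] *)

Section Geometry.
Context {R : realType} {A : finType}.
Variables (M : rel A) (u : Sigma M -> R) (rep : seq A -> Sigma M) (C c : R).
Hypothesis repP : forall w, admissible M w -> cylinder w (rep w).
Hypothesis u_reg : regular u C.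
Hypotheses (c_gt0 : 0 < c) (u_ge : forall xi, c <= u xi).
Implicit Types (xi eta : Sigma M) (w : seq A).

Local Notation block xi n := (mkseq (val xi) n).
Local Notation U := (word_sum rep u).

Let C_ge0 : 0 <= C. Proof. by case: u_reg. Qed.

Lemma du_ge0 xi eta : 0 <= du u xi eta.
Proof. by rewrite /du; case: pselect => // E; exact: expR_ge0. Qed.

Lemma word_sum_ge w : c * (size w)%:R <= U w.
Proof. exact: birkhoff_sum_ge. Qed.

Lemma birkhoff_sumN n f xi :
  birkhoff_sum n (\- f) xi = - birkhoff_sum n f xi :> R.
Proof. by rewrite /birkhoff_sum sumrN. Qed.

Lemma birkhoff_sum_mono m n xi : (m <= n)%N ->
  birkhoff_sum m u xi <= birkhoff_sum n u xi.
Proof.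
move=> mn; rewrite -(subnKC mn) birkhoff_sumD lerDl.
by apply: le_trans (birkhoff_sum_ge _ _ u_ge); rewrite mulr_ge0 // ltW.
Qed.

(** Positivity of [u] makes its Birkhoff sums increase with length. The bound serves [du_le]
    directly, and [du_ge] by showing that the real supremum is taken over a bounded set. *)
Lemma word_birkhoff_sumN_ubound w xi n : cylinder w xi -> (size w <= n)%N ->
  ubound [set birkhoff_sum (size (block xi n)) (\- u) eta | eta in cylinder (block xi n)]
    (C - U w).
Proof.
move=> wxi wn _ [eta + <-]; rewrite size_mkseq cylinder_mkseq => E.
have weta : cylinder w eta.
  by rewrite /cylinder /= -[RHS]wxi; exact: eq_block_le E.
rewrite birkhoff_sumN; have := word_sum_dist repP u_reg weta.
by have := birkhoff_sum_mono eta wn; rewrite ler_norml; lra.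
Qed.

Lemma du_le w xi eta : cylinder w xi -> cylinder w eta ->
  du u xi eta <= expR (C - U w).
Proof.
move=> wxi weta; rewrite /du; case: pselect => [E|neq]; first exact: expR_ge0.
rewrite ler_expR /word_birkhoff_sum /common_block.
apply: ge_sup; first by eexists; exists xi; first exact: cylinder_block.
apply: word_birkhoff_sumN_ubound => //.
by apply/(common_lengthP neq).2; rewrite wxi weta.
Qed.

Lemma du_ge xi eta : xi <> eta ->
  expR (- C - U (block xi (common_length xi eta))) <= du u xi eta.
Proof.
move=> neq; rewrite /du; case: pselect => // neq'.
rewrite ler_expR /word_birkhoff_sum /common_block.
set w := block _ _.
apply: (@le_trans _ _ (birkhoff_sum (size w) (\- u) xi)).
  rewrite birkhoff_sumN.
  have := word_sum_dist repP u_reg (cylinder_block xi (common_length xi eta)).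
  by rewrite ler_norml -/w; lra.
apply: ub_le_sup; last by exists xi => //; exact: cylinder_block.
exists (C - U w); apply: word_birkhoff_sumN_ubound; first exact: cylinder_block.
by rewrite size_mkseq.
Qed.

Lemma diameter_cylinder w : (diameter (du u) (cylinder w) <= (expR (C - U w))%:E)%E.
Proof.
apply: ge_ereal_sup => _ [[xi eta] [wxi weta] <-]; rewrite lee_fin.
exact: du_le.
Qed.

Lemma diameter_pow_cylinder s w : 0 <= s ->
  (diameter_pow (du u) s (cylinder w) <=
    (expR (s * C) * expR (- (s * U w)))%:E)%E.
Proof.
move=> s0; rewrite /diameter_pow; case: eqP => [_|/eqP/set0P[xi wxi]].
  by rewrite lee_fin mulr_ge0 ?expR_ge0.
have -> : expR (s * C) * expR (- (s * U w)) = expR (C - U w) `^ s.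
  by rewrite -expRD -expRM; congr expR; ring.
have diam0 : (0 <= diameter (du u) (cylinder w))%E.
  apply: le_ereal_sup_tmp; exists (du u xi xi)%:E; last by rewrite lee_fin du_ge0.
  by exists (xi, xi).
rewrite -poweR_EFin gt0_ler_poweR // ?in_itv /= ?leey ?andbT //.
exact: diameter_cylinder.
Qed.

(** A pair of points of [V] with the shortest common block gives a cylinder containing [V] of
    comparable diameter; diameter at most 1 allows the change of exponent. If [V] has at most one
    point, a long cylinder of weight at most [e] is taken. *)
Lemma set_in_cylinder s s0 (V : set (Sigma M)) e : 0 <= s -> s <= s0 -> 0 < s0 ->
  0 < e -> (exists xi : Sigma M, True) -> (diameter (du u) V <= 1)%E -> exists w,
  V `<=` cylinder w /\ ((expR (- (s0 * U w)))%:E <=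
    (expR (s0 * C))%:E * diameter_pow (du u) s V + e%:E)%E.
Proof.
move=> s_ge0 ss0 s0_gt0 e0 [xi1 _] V1.
pose P n := exists xi eta, [/\ V xi, V eta, xi <> eta & common_length xi eta = n].
have [[n Pn]|noP] := pselect (exists n, P n); last first.
  have [xi Vxi] : exists xi, V `<=` [set xi].
    have [[xi Vxi]|nV] := pselect (exists xi, V xi); last first.
      by exists xi1 => eta Veta; case: nV; exists eta.
    exists xi => eta Veta /=; apply: contrapT => neq; apply: noP.
    by exists (common_length eta xi), eta, xi.
  pose n := Num.bound (e * (s0 * c))^-1.
  exists (block xi n); split=> [eta /Vxi ->|]; first exact: cylinder_block.
  rewrite -[leLHS]add0e leeD //.
    by rewrite mule_ge0 ?lee_fin ?expR_ge0 ?diameter_pow_ge0.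
  have sc0 : 0 < s0 * c by rewrite mulr_gt0.
  have le1 : s0 * c * n%:R <= s0 * U (block xi n).
    rewrite -mulrA ler_wpM2l ?(ltW s0_gt0) //.
    by have := word_sum_ge (block xi n); rewrite size_mkseq.
  rewrite lee_fin expRN invf_ple ?posrE ?expR_gt0 //.
  apply: le_trans (_ : _ <= s0 * c * n%:R) _; last first.
    by apply: le_trans (expR_ge1Dx _); rewrite ler_wpDl.
  rewrite -ler_pdivrMl // -invfM mulrC.
  by apply/ltW/archi_boundP; rewrite invr_ge0 mulr_ge0 // ltW.
have exP : exists n, `[< P n >] by exists n; apply/asboolP.
case: (ex_minnP exP) => m /asboolP[xi [eta [Vxi Veta neq lm]]] min_m {n Pn exP}.
exists (block xi m); split.
  move=> zeta Vzeta; rewrite cylinder_mkseq.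
  have [->//|neq'] := pselect (zeta = xi).
  apply/(common_lengthP neq').2; apply: min_m; apply/asboolP.
  by exists zeta, xi.
set w := block xi m.
have dV : ((expR (- C - U w))%:E <= diameter (du u) V)%E.
  apply: le_ereal_sup_tmp; exists (du u xi eta)%:E; first by exists (xi, eta).
  by rewrite lee_fin /w -lm; exact: du_ge.
rewrite /diameter_pow; case: eqP => [V0|_]; first by rewrite V0 in Vxi.
move: dV V1; case: (diameter _ _) => [D|//|//]; rewrite !lee_fin => dV V1.
have D0 : 0 < D by apply: lt_le_trans dV; exact: expR_gt0.
rewrite ler_wpDr ?(ltW e0) //.
have -> : expR (- (s0 * U w)) = expR (s0 * C) * expR (- C - U w) `^ s0.
  by rewrite -expRM -expRD; congr expR; ring.
rewrite ler_wpM2l ?expR_ge0 //; apply: (@le_trans _ _ (D `^ s0)).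
  by rewrite ge0_ler_powR ?nnegrE ?expR_ge0 ?(ltW D0) ?(ltW s0_gt0).
by apply: ger_powR => //; rewrite D0.
Qed.

(** The sets of a fine cover of [E] are enlarged to cylinders, and [fan] extracts finitely many of
    them. *)
Lemma hausdorff_small_covers (f : Sigma M -> R) Cf (E : set (Sigma M)) s s0 :
  regular f Cf -> 0 <= s -> s < s0 -> (exists xi : Sigma M, True) ->
  (forall K xi, (forall n, `|birkhoff_sum n f xi| <= K) -> E xi) ->
  hausdorff_measure (du u) s E = 0%E ->
  small_covers M (word_sum rep f) (fun w => expR (- (s0 * U w))).
Proof.
move=> f_reg s_ge0 ss0 inh EP /hausdorff_measure_eq0P HE K delta delta0.
have s0_gt0 : 0 < s0 by exact: le_lt_trans ss0.
(* Half of [delta] is for the cover, half for the errors of [set_in_cylinder], summed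
   geometrically. *)
pose t := delta / 2 / expR (s0 * C).
have t0 : 0 < t by rewrite !divr_gt0 // expR_gt0.
have [V [EV V1 Vsum]] := HE 1 t ltr01 t0.
have /choice[W HW] : forall k, exists w, V k `<=` cylinder w /\
   ((expR (- (s0 * U w)))%:E <= (expR (s0 * C))%:E * diameter_pow (du u) s (V k)
     + (delta / 2 * 2^-1 ^+ k.+1)%:E)%E.
  move=> k; apply: set_in_cylinder => //; first exact: ltW.
  by rewrite mulr_gt0 ?exprn_gt0 ?divr_gt0 ?invr_gt0.
(* A sequence none of whose prefixes is inadmissible or has a large sum is a point of [E], hence
   enters some [W k]. *)
have [|N HN] := @fan A (fun k w => w = W k \/
    ~ (admissible M w /\ `|word_sum rep f w| <= K)).
  move=> x.
  have [Hx|/existsNP[n Hn]] := pselect (forall n, admissible M (mkseq x n) /\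
      `|word_sum rep f (mkseq x n)| <= K); last by exists n, 0%N; right.
  have xS : Sigma M x.
    move=> n; have [+ _] := Hx n.+2 => /(sortedP (x 0%N))/(_ n).
    by rewrite size_mkseq !nth_mkseq //; apply.
  pose xi : Sigma M := SigSub (mem_set xS).
  have [k _ Vk] : (\bigcup_k V k) xi.
    apply/EV/(EP (K + Cf)) => n.
    have := word_sum_dist repP f_reg (cylinder_block xi n).
    have := (Hx n).2; rewrite size_mkseq -/(block xi n) !ler_norml; lra.
  exists (size (W k)), k; left; exact: (HW k).1 Vk.
exists N, [seq W k | k <- iota 0 N]; split; last first.
  move=> y ady Ky /HN[n [k [ny kN]]] [E'|[]].
    exists (W k); first by apply/mapP; exists k => //; rewrite mem_iota.
    by rewrite -E' prefix_take.
  split; last exact: Ky.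
  by move: ady; rewrite -{1}(cat_take_drop n y) => /cat_sorted2[].
rewrite big_map -[X in iota 0 X]subn0 -lee_fin -sumEFin.
apply: le_trans (lee_sum _ (fun k _ => (HW k).2)) _.
rewrite big_split /= -ge0_sume_distrr; last by move=> k _; exact: diameter_pow_ge0.
have deltaE : delta = expR (s0 * C) * t + delta / 2.
  by rewrite /t; field; rewrite gt_eqF ?expR_gt0.
rewrite [in X in (_ <= X)%E]deltaE EFinD leeD //.
  rewrite EFinM lee_wpmul2l ?lee_fin ?expR_ge0 //; apply: le_trans (ltW Vsum).
  by apply: nneseries_lim_ge => k _ _; exact: diameter_pow_ge0.
rewrite sumEFin lee_fin -mulr_sumr ler_piMr ?divr_ge0 ?(ltW delta0) //.
elim: N {HN} => [|N IH]; first by rewrite big_nil.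
have -> : \sum_(k <- iota 0 (N.+1 - 0)) 2^-1 ^+ k.+1 =
  2^-1 * (1 + \sum_(k <- iota 0 (N - 0)) 2^-1 ^+ k.+1) :> R.
  rewrite (big_nat_recl N 0 (fun k => 2^-1 ^+ k.+1)) // mulrDr mulr1 mulr_sumr.
  by congr (_ + _); apply: eq_bigr => k _; rewrite exprS.
lra.
Qed.

(** Borel-Cantelli argument: the good cylinders of length at least [N] cover [L], and their total
    weight is at most a constant times the tail of a geometric series. *)
Lemma hausdorff_measure_cylinders_eq0 (L : set (Sigma M)) (good : pred (seq A))
    s q n0 : 0 < s -> 0 <= q -> q < 1 ->
  (forall n, (n0 <= n)%N ->
    \sum_(w <- words A n | good w) expR (- (s * U w)) <= q ^+ n) ->
  (forall xi N, L xi -> exists2 n, (N <= n)%N & good (block xi n)) ->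
  hausdorff_measure (du u) s L = 0%E.
Proof.
move=> s0 q0 q1 Hsum Hgood.
apply/hausdorff_measure_eq0P => delta e delta0 e0.
have q1' : 0 < 1 - q by rewrite subr_gt0.
pose k := expR (s * C).
have k0 : 0 < k by exact: expR_gt0.
have [N1 HN1] : exists N1, forall N, (N1 <= N)%N -> k * (q ^+ N / (1 - q)) < e.
  have /cvgrPdist_lt/(_ (e * (1 - q) / k)) : q ^+ n @[n --> \oo] --> (0 : R).
    by apply: cvg_expr; rewrite ger0_norm.
  rewrite !(divr_gt0, mulr_gt0) // => /(_ isT)[N1 _ HN1].
  exists N1 => N /HN1 /=; rewrite sub0r normrN ger0_norm ?exprn_ge0 //.
  by rewrite ltr_pdivlMr // mulrA ltr_pdivrMr // mulrC.
(* Beyond length [N2] all cylinders have diameter at most [delta]. *)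
pose N2 := Num.bound (expR C / (delta * c)).
have HN2 N : (N2 <= N)%N -> expR (C - c * N%:R) <= delta.
  move=> leN; rewrite expRD expRN ler_pdivrMr ?expR_gt0 //.
  have dc : 0 < delta * c by rewrite mulr_gt0.
  have : 0 <= expR C / (delta * c) by rewrite divr_ge0 ?expR_ge0 // ltW.
  move=> /archi_boundP/ltW; rewrite ler_pdivrMr // => /le_trans; apply.
  rewrite mulrC -mulrA ler_wpM2l ?(ltW delta0) //.
  apply: le_trans (expR_ge1Dx _); rewrite ler_wpDl // ler_wpM2l ?(ltW c_gt0) //.
  by rewrite ler_nat.
pose N := maxn n0 (maxn N1 N2).
have [n0N N1N N2N] : [/\ (n0 <= N)%N, (N1 <= N)%N & (N2 <= N)%N].
  by rewrite !leq_max !leqnn ?orbT.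
pose V j := if pickle_inv j is Some w then
   (if good w && (N <= size w)%N then cylinder w else set0) else set0 : set (Sigma M).
pose g w := if good w && (N <= size w)%N then k * expR (- (s * U w)) else 0.
have g0 w : 0 <= g w by rewrite /g; case: ifP => // _; rewrite mulr_ge0 ?expR_ge0.
exists V; split.
- move=> xi /(Hgood xi N)[n nN gn]; exists (pickle (block xi n)) => //.
  by rewrite /V pickleK_inv gn size_mkseq nN; exact: cylinder_block.
- have diam0 : (diameter (du u) set0 <= delta%:E)%E.
    by apply: ge_ereal_sup => _ [p [[]]].
  move=> j; rewrite /V; case: pickle_inv => [w|//]; case: ifP => // /andP[_ Nw].
  apply: le_trans (diameter_cylinder w) _; rewrite lee_fin.
  apply: le_trans (HN2 _ (leq_trans N2N Nw)).
  by rewrite ler_expR lerD2l lerN2 word_sum_ge.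
- apply: (@le_lt_trans _ _ (k * (q ^+ N / (1 - q)))%:E); last first.
    by rewrite lte_fin HN1.
  apply: lime_le.
    by apply: is_cvg_nneseries => j _ _; exact: diameter_pow_ge0.
  apply: nearW => m /=.
  apply: (@le_trans _ _ (\sum_(0 <= j < m) (oapp g 0 (pickle_inv j))%:E)%E).
    apply: lee_sum => j _; rewrite /V; case: pickle_inv => [w|] /=; last first.
      by rewrite /diameter_pow eqxx.
    rewrite /g; case: ifP => _; last by rewrite /diameter_pow eqxx.
    exact/diameter_pow_cylinder/ltW.
  rewrite sumEFin lee_fin; have [n Hn] := sum_pickle_words m g0.
  apply: le_trans Hn _; apply: le_trans (ler_wpM2l (ltW k0) (geometric_tail N n q0 q1)).
  rewrite mulr_sumr ler_sum // => i _; case: ifP => Ni; last first.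
    rewrite mulr0 big_seq big1 // => w; rewrite mem_words => /eqP wi.
    by rewrite /g wi Ni andbF.
  apply: le_trans (ler_wpM2l (ltW k0) (Hsum i (leq_trans n0N Ni))).
  rewrite mulr_sumr [leRHS]big_mkcond /= ler_sum // => w _.
  rewrite /g; case: (good w) => //=; case: ifP => // _.
  by rewrite mulr_ge0 ?expR_ge0 // ltW.
Qed.

End Geometry.

(** * Level sets *)

Section LevelSets.
Context {R : realType} {A : finType}.
Variables (M : rel A) (psi v : Sigma M -> R) (alpha : R).

Let f xi := psi xi - alpha * v xi.

Lemma birkhoff_sum_subZ n xi : birkhoff_sum n f xi =
  birkhoff_sum n psi xi - alpha * birkhoff_sum n v xi.
Proof. by rewrite /birkhoff_sum sumrB mulr_sumr. Qed.

Lemma uniform_level_setP xi : uniform_level_set psi v alpha xi <->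
  exists K, forall n, `|birkhoff_sum n f xi| <= K.
Proof.
split=> [|[K HK]]; last first.
  apply: le_lt_trans (ltry K); apply: ge_ereal_sup => _ [n _ <-].
  by rewrite lee_fin -birkhoff_sum_subZ.
rewrite /uniform_level_set /=; set S := [set _ | _ in _].
have HS n : (0 < n)%N -> (`|birkhoff_sum n f xi|%:E <= ereal_sup S)%E.
  by move=> n0; apply: ereal_sup_ubound; exists n; rewrite -?birkhoff_sum_subZ.
case: (ereal_sup S) HS => [r| |] // HS _; last by have := HS 1%N isT.
exists r => -[|n]; last by have := HS n.+1 isT; rewrite lee_fin.
(* The supremum starts at [n = 1]; the empty sum is 0 and needs only that the bound is
   nonnegative. *)
rewrite /birkhoff_sum big_geq // normr0.
by have := HS 1%N isT; rewrite lee_fin; apply: le_trans.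
Qed.

(** The quotient differs from [alpha] by at most [K / (c * n)], as the sums of [v] are at most
    [- c * n]. *)
Lemma uniform_level_set_sub c : 0 < c -> (forall xi, c <= - v xi) ->
  uniform_level_set psi v alpha `<=` level_set psi v alpha.
Proof.
move=> c0 vc xi /uniform_level_setP[K HK]; apply/cvgrPdist_le => e e0.
exists (Num.bound (`|K| / (c * e))).+1 => // n /= Kn.
have n0 : (0 < n)%N by exact: leq_trans Kn.
have vn : c * n%:R <= - birkhoff_sum n v xi.
  by rewrite -birkhoff_sumN; exact: birkhoff_sum_ge.
have cn : 0 < c * n%:R by rewrite mulr_gt0 // ltr0n.
have vn0 : birkhoff_sum n v xi < 0 by rewrite -oppr_gt0 (lt_le_trans cn).
have -> : alpha - birkhoff_sum n psi xi / birkhoff_sum n v xi =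
    - birkhoff_sum n f xi / birkhoff_sum n v xi.
  by rewrite birkhoff_sum_subZ; field; rewrite lt_eqF.
rewrite normrM normfV normrN [X in _ / X]ltr0_norm // ler_pdivrMr ?oppr_gt0 //.
apply: le_trans (HK n) _; apply: le_trans (ler_norm K) _.
apply: (@le_trans _ _ (e * (c * n%:R))); last by rewrite ler_wpM2l ?(ltW e0).
have ce : 0 < c * e by rewrite mulr_gt0.
have : 0 <= `|K| / (c * e) by rewrite divr_ge0 // ltW.
move=> /archi_boundP/ltW; rewrite ler_pdivrMr // => /le_trans; apply.
have -> : e * (c * n%:R) = n%:R * (c * e) by ring.
by rewrite ler_wpM2r ?(ltW ce) // ler_nat ltnW.
Qed.

Lemma level_set_small C xi eps : (forall xi, `|v xi| <= C) ->
  (forall xi, v xi < 0) -> level_set psi v alpha xi -> 0 < eps ->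
  exists N, forall n, (N <= n)%N -> `|birkhoff_sum n f xi| <= eps * n%:R.
Proof.
move=> vC v0 /cvgrPdist_le lim eps0.
have C0 : 0 <= C by apply: le_trans (vC xi).
have C1 : 0 < C + 1 by rewrite ltr_wpDl.
have /lim[N _ HN] : 0 < eps / (C + 1) by rewrite divr_gt0.
exists N.+1 => n Nn; have /HN /= : (N <= n)%N by exact: ltnW.
have vn0 : birkhoff_sum n v xi < 0.
  rewrite -oppr_gt0 -sumrN /birkhoff_sum.
  case: n Nn => // n _; rewrite big_nat_recr //= ltr_wpDl ?oppr_gt0 //.
  by rewrite sumr_ge0 // => k _; rewrite oppr_ge0 ltW.
have -> : alpha - birkhoff_sum n psi xi / birkhoff_sum n v xi =
    - birkhoff_sum n f xi / birkhoff_sum n v xi.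
  by rewrite birkhoff_sum_subZ; field; rewrite lt_eqF.
have vn := birkhoff_sum_le n xi vC.
rewrite normrM normfV normrN ler_pdivrMr ?normr_gt0 ?lt_eqF // => /le_trans; apply.
apply: (@le_trans _ _ (eps / (C + 1) * ((C + 1) * n%:R))).
  rewrite ler_wpM2l ?divr_ge0 ?(ltW eps0) ?(ltW C1) //.
  by rewrite (le_trans vn) // ler_wpM2r // lerDl.
by rewrite mulrA divfK ?gt_eqF.
Qed.

End LevelSets.

Theorem proposition1p1 (R : realType) (A : finType) (M : rel A)
    (cardA : (1 < #|A|)%N)
    (M_follow : forall a : A, exists b : A, M a b)
    (M_trans : topologically_transitive M)
    (psi v u : Sigma M -> R)
    (psi_hoelder : hoelder_continuous psi)
    (v_hoelder : hoelder_continuous v)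
    (u_hoelder : hoelder_continuous u)
    (v_lt0 : forall xi : Sigma M, v xi < 0)
    (u_gt0 : forall xi : Sigma M, 0 < u xi)
    (alpha : R) :
  dim_u u (uniform_level_set psi v alpha) = dim_u u (level_set psi v alpha).
Proof.
have A0 : (0 < #|A|)%N by exact: ltnW.
have [rep repP] := representatives_exist M_follow A0.
have inh : exists xi : Sigma M, True by exists (rep [::]).
have [Cp psi_reg] := hoelder_regular psi_hoelder.
have [Cv v_reg] := hoelder_regular v_hoelder.
have [Cu u_reg] := hoelder_regular u_hoelder.
have f_reg := regularB alpha psi_reg v_reg.
set f := (fun xi => psi xi - alpha * v xi) in f_reg.
set Cf := Cp + _ in f_reg.
have [cu cu0 u_ge] := hoelder_gt0_bound u_hoelder u_gt0.
have [cv cv0 v_le] : exists2 c, 0 < c & forall xi, c <= - v xi.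
  apply: hoelder_gt0_bound => [|xi]; last by rewrite oppr_gt0.
  have [e [C [e0 H]]] := v_hoelder; exists e, C; split=> // xi eta.
  by rewrite -opprD normrN.
have subL := uniform_level_set_sub (psi := psi) (alpha := alpha) cv0 v_le.
apply/eqP; rewrite eq_le; apply/andP; split.
  apply: ereal_inf_le_tmp => _ [s [s0 Hs] <-]; exists s => //; split=> //.
  exact: hausdorff_measure_eq0_sub subL Hs.
apply: le_ereal_inf_tmp => _ [s [s_ge0 Hs] <-].
apply/lee_addgt0Pr => e e0; rewrite -EFinD.
apply: ereal_inf_lbound; exists (s + e) => //; split; first by rewrite addr_ge0 // ltW.
pose s0 := s + e / 2.
have ss0 : s < s0 by rewrite ltrDl divr_gt0.
have s0_gt0 : 0 < s0 by exact: le_lt_trans ss0.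
have [Cf0 _ _] := f_reg; have [Cu0 u_le _] := u_reg.
pose F := word_sum rep f; pose U := word_sum rep u.
pose phi w := expR (- (s0 * U w)).
have F_add : almost_additive M F (2 * Cf) by exact: word_sum_additive.
have U_add : almost_additive M U (2 * Cu) by exact: word_sum_additive.
have cov : small_covers M F phi.
  apply: (hausdorff_small_covers repP u_reg cu0 u_ge f_reg s_ge0 ss0 inh _ Hs).
  by move=> K xi HK; apply/uniform_level_setP; exists K.
have U_ge w : cu * (size w)%:R <= U w by exact: birkhoff_sum_ge.
pose eta := e / 2 * cu / 2.
have eta0 : 0 < eta by rewrite !(divr_gt0, mulr_gt0).
have [|||||||eps [n0 [eps0 growF]]] := @growth R A M F phi (Cf + s0 * Cu)
    (2 * Cf) (s0 * (2 * Cu)) M_trans F_add _ _ _ _ _ _ _ cov eta eta0.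
- by rewrite addr_ge0 // mulr_ge0 // ltW.
- move=> w _; apply: le_trans (word_sum_le rep f_reg w) _.
  by rewrite ler_wpM2r // lerDl mulr_ge0 // ltW.
- by move=> w; exact: expR_gt0.
- by rewrite /phi U_add.1 mulr0 oppr0 expR0.
- move=> a; rewrite /phi -expR0 ler_expR oppr_le0 mulr_ge0 ?(ltW s0_gt0) //.
  by apply: le_trans (U_ge [:: a]); rewrite mulr_ge0 // ltW.
- move=> p w adm; have := U_add.2 p w adm.
  rewrite -(ler_pM2l s0_gt0) -[X in X * `|_|](gtr0_norm s0_gt0) -normrM ler_norml.
  by move=> /andP[le1 le2]; rewrite /phi -!expRD !ler_expR; split; lra.
- move=> w _; rewrite ler_expR lerN2.
  apply: (@le_trans _ _ (s0 * (Cu * (size w)%:R))).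
    rewrite ler_wpM2l ?(ltW s0_gt0) //.
    by apply: le_trans (word_sum_le rep u_reg w); exact: ler_norm.
  by rewrite mulrA ler_wpM2r // lerDr.
pose good w := admissible M w && (`|F w| <= eps * (size w)%:R).
apply: (@hausdorff_measure_cylinders_eq0 _ _ _ _ _ _ _ repP u_reg cu0 u_ge
  _ good _ (expR (- eta)) n0).
- by rewrite ltr_wpDl.
- exact: expR_ge0.
- by rewrite expR_lt1 oppr_lt0.
- move=> n n0n; rewrite -expRM_natl.
  apply: (@le_trans _ _ (expR (- (2 * eta * n%:R)) *
    \sum_(w <- words A n | admissible M w && (`|F w| <= eps * n%:R)) phi w)); last first.
    apply: le_trans (ler_wpM2l (expR_ge0 _) (growF n n0n)) _.
    by rewrite -expRD ler_expR; lra.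
  rewrite mulr_sumr big_seq_cond [leRHS]big_seq_cond.
  rewrite (eq_bigl (fun w => (w \in words A n) &&
      (admissible M w && (`|F w| <= eps * n%:R)))); last first.
    by move=> w; rewrite /good; case: (boolP (w \in words A n)) => //;
      rewrite mem_words => /eqP ->.
  rewrite ler_sum // => w /andP[]; rewrite mem_words => /eqP wn _.
  rewrite /phi -expRD ler_expR /s0 /eta -/U.
  have := U_ge w; rewrite wn => Uw.
  have : e / 2 * (cu * n%:R) <= e / 2 * U w by rewrite ler_wpM2l // divr_ge0 // ltW.
  lra.
- move=> xi N Lxi; have eps2 : 0 < eps / 2 by rewrite divr_gt0.
  have [|N1 HN1] := level_set_small (C := Cv) _ v_lt0 Lxi eps2.
    by case: v_reg.
  pose N2 := Num.bound (Cf / (eps / 2)).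
  exists (maxn N (maxn N1 N2)); first exact: leq_maxl.
  set n := maxn _ _.
  rewrite /good admissible_block size_mkseq.
  have /HN1 : (N1 <= n)%N by rewrite !leq_max leqnn orbT.
  have := word_sum_dist repP f_reg (cylinder_block xi n); rewrite size_mkseq.
  have : Cf <= eps / 2 * n%:R.
    rewrite mulrC -ler_pdivrMr //.
    have /archi_boundP/ltW/le_trans : 0 <= Cf / (eps / 2) by rewrite divr_ge0 // ltW.
    by apply; rewrite ler_nat !leq_max leqnn !orbT.
  by rewrite -/f -/F !ler_norml; lra.
Qed.
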